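(* Assume that $\|\Gamma_\infty A\Gamma_\infty\|_{2\to2}<1$, and for each $n\in\mathbb{N}$ let $\Sigma_n=\mathbb{E}_{\mu_{J_n}}\big[\widehat m^{(n)}(\widehat m^{(n)})^T\big]$. For $Z\sim\mathcal{N}(0,\mathrm{Id})$ (standard normal in $\mathbb{R}^k$), as $n\to\infty$, $$\sup_{h\in\mathcal{F}_3}\Big|\mathbb{E}_{\mu_{J_n}}\big[h(\widehat m^{(n)})\big]-\mathbb{E}\,h(\Sigma_n^{1/2}Z)\Big|=O(N^{-1/2}).$$
   Context: Setting (block spin Ising model). Let $k\in\mathbb{N}$ and let $A\in\mathbb{R}^{k\times k}$ be symmetric and positive definite (the block interaction matrix). Let $N=N(n)$ be a strictly increasing sequence in $\mathbb{N}$, and for each $n$ let $B_1^{(n)},\dots,B_k^{(n)}$ be a partition of $\{1,\dots,N\}$ into $k$ (nonempty) blocks, ordered so that $i_0\in B_i^{(n)}$, $j_0\in B_j^{(n)}$, $i<j$ implies $i_0<j_0$. Assume that for each $i$ the limit $\gamma_i=\lim_{n\to\infty}\sqrt{|B_i^{(n)}|/N}\in(0,1)$ exists, and put $\Gamma_\infty=\mathrm{diag}(\gamma_1,\dots,\gamma_k)$. Let $h(a)$ denote the index of the block containing $a\in\{1,\dots,N\}$ and let $J_n\in\mathbb{R}^{N\times N}$ be the matrix with entries $(J_n)_{ab}=\frac1N A_{h(a)h(b)}$. Let $\mu_{J_n}$ be the probability measure on $\{-1,+1\}^N$ given by $\mu_{J_n}(x)=Z_n^{-1}\exp(\frac12\langle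 x,J_nx\rangle)$, with $Z_n$ the normalizing constant. (The block index map $h(a)$ is unrelated to the test functions $h\in\mathcal{F}_3$.) For $x\in\{-1,+1\}^N$, $\widehat m^{(n)}(x)\in\mathbb{R}^k$ has components $\widehat m^{(n)}_i(x)=\frac{1}{\sqrt{|B_i^{(n)}|}}\sum_{j\in B_i^{(n)}}x_j$. $\|\cdot\|_{2\to2}$ is the operator norm with respect to the Euclidean norm. The function class is $$\mathcal{F}_3=\Big\{h:\mathbb{R}^k\to\mathbb{R}:\ h\in\mathcal{C}^3(\mathbb{R}^k),\ \max_{j=1,2,3}\max_{|\alpha|=j}\sup_{x\in\mathbb{R}^k}|\partial^\alpha h(x)|\le1\Big\},$$ where $\alpha$ runs over multi-indices of order $j$. The constant in $O(N^{-1/2})$ is independent of $n$. *)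

(* Defs.v *)
From HB Require Import structures.
From mathcomp Require Import all_boot all_order all_algebra.
From mathcomp Require Import all_classical all_reals all_analysis.

Set Implicit Arguments.
Unset Strict Implicit.
Unset Printing Implicit Defensive.

Import Order.TTheory GRing.Theory Num.Theory.
Import numFieldNormedType.Exports.

Local Open Scope classical_set_scope.
Local Open Scope ring_scope.

Section Matrices.
Variables (R : realType) (k : nat).
Implicit Types (M S : 'M[R]_k) (v : 'cV[R]_k).

Definition quadform M v : R := (v^T *m M *m v) ord0 ord0.

Definition posdefmx M := M \is symmetricmx /\ forall v, v != 0 -> 0 < quadform M v.

Definition possemidefmx M :=
  M \is symmetricmx /\ forall v, 0 <= quadform M v.

(* The library norm on matrices is the maximum norm, hence this definition. *)
Definition l2norm v : R := Num.sqrt (\sum_(i < k) v i ord0 ^+ 2).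

Definition opnorm2 M : R :=
  sup [set l2norm (M *m v) | v in [set v | l2norm v <= 1]].

(* The positive semidefinite square root M^{1/2}; it exists and is unique
   whenever M is positive semidefinite (junk value otherwise). *)
Definition sqrtmx M : 'M[R]_k :=
  get [set S | possemidefmx S /\ S *m S = M].

End Matrices.

Section SmoothFunctions.
Variables (R : realType) (k : nat).
Implicit Types (f h : 'cV[R]_k -> R).

Definition basis_vec (i : 'I_k) : 'cV[R]_k := delta_mx i ord0.

Definition pderiv (i : 'I_k) f : 'cV[R]_k -> R :=
  fun x => 'D_(basis_vec i) f x.

Fixpoint Cn (m : nat) f : Prop :=
  if m is m'.+1 then
    continuous f /\
    forall i : 'I_k,
      (forall x, derivable f x (basis_vec i)) /\ Cn m' (pderiv i f)
  else continuous f.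

Definition multi_index_deriv (alpha : 'I_k -> nat) f : 'cV[R]_k -> R :=
  foldr (fun i g => iter (alpha i) (pderiv i) g) f (enum 'I_k).

Definition F3 : set ('cV[R]_k -> R) :=
  [set h | Cn 3 h /\
    forall alpha : 'I_k -> nat, (1 <= \sum_(i < k) alpha i <= 3)%N ->
      forall x, `|multi_index_deriv alpha h x| <= 1].

End SmoothFunctions.

Section Ising.
Variables (R : realType) (N : nat).

(* Spin configurations in {-1,+1}^N, encoded by sign bits: [false] is +1 and
   [true] is -1. *)
Definition config := {ffun 'I_N -> bool}.
Implicit Types (x : config) (J : 'M[R]_N).

Definition spin x : 'cV[R]_N := \col_a (-1) ^+ x a.

Definition ising_weight J x : R := expR (2^-1 * quadform J (spin x)).

Definition partition_function J : R := \sum_(x : config) ising_weight J x.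

Definition ising_measure J x : R := ising_weight J x / partition_function J.

Definition ising_expectation (V : lmodType R) J (f : config -> V) : V :=
  \sum_(x : config) ising_measure J x *: f x.

Variable k : nat.

Definition ordered_blocks (B : 'I_k -> {set 'I_N}) : Prop :=
  [/\ forall i, (0 < #|B i|)%N,
      forall i j, i != j -> B i :&: B j = finset.set0,
      forall a, exists i, a \in B i
    & forall i j a b, a \in B i -> b \in B j -> (i < j)%N -> (a < b)%N].

Definition block_index (B : 'I_k -> {set 'I_N}) (b : 'I_N -> 'I_k) : Prop :=
  forall a, a \in B (b a).

Definition block_interaction (A : 'M[R]_k) (b : 'I_N -> 'I_k) : 'M[R]_N :=
  \matrix_(a, a') (N%:R^-1 * A (b a) (b a')).

Definition block_magnetization (B : 'I_k -> {set 'I_N}) x : 'cV[R]_k :=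
  \col_i ((Num.sqrt #|B i|%:R)^-1 * \sum_(j in B i) spin x j ord0).

Definition magnetization_covariance (J : 'M[R]_N) (B : 'I_k -> {set 'I_N}) :
    'M[R]_k :=
  ising_expectation J
    (fun x => block_magnetization B x *m (block_magnetization B x)^T).

End Ising.

Section Gaussian.
Variables (d : measure_display) (T : measurableType d) (R : realType).
Variables (P : probability T R) (k : nat).

(* Z ~ N(0, Id): the coordinates are jointly distributed as the k-fold product
   of the one-dimensional law N(0, 1). *)
Definition standard_normal_vector (Z : 'I_k -> {RV P >-> R}) : Prop :=
  forall E : 'I_k -> set R, (forall i, measurable (E i)) ->
    P [set w | forall i, E i (Z i w)] =
    (\prod_(i < k) normal_prob 0 1 (E i))%E.

Definition random_vector (Z : 'I_k -> {RV P >-> R}) (w : T) : 'cV[R]_k :=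
  \col_i Z i w.

End Gaussian.

(* Main.v *)
Require Import Defs.
From HB Require Import structures.
From mathcomp Require Import all_boot all_order all_algebra.
From mathcomp Require Import all_classical all_reals all_analysis.
From mathcomp Require Import measurable_realfun.
From mathcomp Require Import complex.
From mathcomp Require Import ring lra.

Set Implicit Arguments.
Unset Strict Implicit.
Unset Printing Implicit Defensive.

Import Order.TTheory GRing.Theory Num.Theory.
Import numFieldNormedType.Exports.

Local Open Scope classical_set_scope.
Local Open Scope ring_scope.

(** Let [m] be the vector of rescaled block magnetizations, [Sigma] its covariance
    and [S] the square root of [Sigma]. A centred Gaussian vector with covariance
    [Sigma] is characterized by the identity
    [E (m_j F) = sum_l Sigma_jl E (d_l F)], where [F] is evaluated at the vector;
    the theorem holds because [m] satisfies it up to an error of order [N ^ (-1/2)].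

    Spin side. Given the other spins, spin [a] has mean [tanh theta_a], where
    [theta_a] is the field created by the other spins. This gives an exact identity
    for [E (x_a F)] ([ising_stein]). Summing it over a block and linearizing [tanh]
    yields [E (m_i F) = sum_j M_ij E (m_j F) + E (d_i F)] up to [O(N ^ (-1/2))], with
    [M = Gamma_n A Gamma_n] ([approx_stein]). The remainders are controlled by the
    fourth moment of [m], which is bounded by feeding [F = m_i |m|^2] into the same
    exact identity, as [M] is a contraction ([fourth_moment_le]). With [F = m_l] the
    linearized identity says that [(1 - M) Sigma] is close to the identity matrix;
    as [1 - M] is boundedly invertible, the limit identity with [Sigma] follows
    ([cov_stein]).

    Gaussian side. For [Z] standard normal, [E (Z_p f(Z)) = E (d_p f(Z))] holds
    exactly ([gaussian_ibp]): this is Stein's equation in one variable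
    ([normal_stein]), integrated over the other coordinates by Fubini.

    Comparison. On the path [psi(t) = E h(sin t m + cos t S Z)], [0 <= t <= pi/2],
    with [m] and [Z] independent, the derivative is
    [cos t E (sum_j m_j d_j h) - sin t E (sum_j (S Z)_j d_j h)]. Both identities turn
    its terms into [sin t cos t E (sum_jl Sigma_jl d_jl h)], with opposite signs, and
    only the error of the spin side remains ([gaussian_comparison]). The test
    function on the spin side is [F = d_j h]; the error in its first-order expansion
    along spin flips is controlled by the third derivatives of [h].

    All constants depend only on [k], on the size of [A], on a contraction factor of
    [M] and on a lower bound for the ratios of block sizes to [N]; the latter two
    are uniform in [n] for large [n] ([mean_field_contraction]). *)

(** * The hyperbolic tangent *)

Section Tanh.
Variable R : realType.
Implicit Types t : R.

Definition tanhR t : R := (expR t - expR (- t)) / (expR t + expR (- t)).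

Lemma tanhR_opp t : tanhR (- t) = - tanhR t.
Proof. by rewrite /tanhR opprK -mulNr opprB; congr (_ / _); rewrite addrC. Qed.

Let cosh2_gt0 t : 0 < expR t + expR (- t).
Proof. by rewrite addr_gt0 ?expR_gt0. Qed.

(** The difference of the two sides has derivative [t (exp t - exp (- t))]. *)
Let sinh_le t : 0 <= t -> expR t - expR (- t) <= t * (expR t + expR (- t)).
Proof.
move=> t0; rewrite -subr_ge0.
pose g (x : R) := x * (expR x + expR (- x)) - (expR x - expR (- x)).
pose dg (x : R) := x * (expR x - expR (- x)).
have gd (x : R) : is_derive x 1 g (dg x).
  rewrite /g /dg; apply: is_derive_eq.
  by rewrite /GRing.scale /=; ring.
have gc : {within `[0, t], continuous g}.
  by apply: derivable_within_continuous => x _; have [] := gd x.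
have [c] := @MVT_segment R g dg 0 t t0 (fun x _ => gd x) gc.
rewrite in_itv/= => /andP[c0 _]; rewrite -/(g t) [X in g t - X]/g oppr0 mul0r subrr subr0 subr0 => ->.
rewrite addr0; apply: mulr_ge0 => //.
by apply: mulr_ge0 => //; rewrite subr_ge0 ler_expR; lra.
Qed.

Let tanhR_bounds t : 0 <= t ->
  [/\ 0 <= tanhR t, tanhR t <= t & t - t ^+ 2 <= tanhR t].
Proof.
move=> t0; have c0 := cosh2_gt0 t.
rewrite /tanhR; split.
- by rewrite divr_ge0 ?(ltW c0)// subr_ge0 ler_expR; lra.
- by rewrite ler_pdivrMr// sinh_le.
rewrite ler_pdivlMr//.
have e1 := expR_ge1Dx t; have e2 := expR_ge1Dx (- t).
have e3 : expR t * expR (- t) = 1 by rewrite -expRD subrr expR0.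
have e4 : expR t * expR t >= 1 + t + t.
  by rewrite -expRD; have := expR_ge1Dx (t + t); lra.
have p := expR_gt0 (- t).
rewrite -subr_ge0 -(pmulr_rge0 _ (expR_gt0 t)).
have -> : expR t * (expR t - expR (- t) - (t - t ^+ 2) * (expR t + expR (- t)))
  = expR t * expR t * (1 - t + t ^+ 2) - (1 + t - t ^+ 2).
  have -> : expR t * (expR t - expR (- t) - (t - t ^+ 2) * (expR t + expR (- t)))
    = expR t * expR t * (1 - t + t ^+ 2) - (expR t * expR (- t)) * (1 + t - t ^+ 2) by ring.
  by rewrite e3 mul1r.
have q0 : 0 <= 1 - t + t ^+ 2 by nra.
have := ler_wpM2r q0 e4.
by nra.
Qed.

(** At [t = 0] the slope takes the value [0], which is harmless as it only ever
    multiplies [t]. *)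
Definition tanh_slope t : R := tanhR t / t.

Lemma tanh_slopeE t : tanhR t = tanh_slope t * t.
Proof.
have [->|t0] := eqVneq t 0; last by rewrite divfK.
by rewrite mulr0 /tanhR oppr0 subrr mul0r.
Qed.

Lemma tanh_slope01 t : 0 <= tanh_slope t <= 1.
Proof.
wlog t0 : t / 0 <= t.
  move=> H; have [/H//|/ltW t0] := leP 0 t.
  have := H (- t); rewrite oppr_ge0 => /(_ t0).
  by rewrite /tanh_slope tanhR_opp invrN mulrNN.
have [h1 h2 _] := tanhR_bounds t0; rewrite divr_ge0//=.
rewrite /tanh_slope; have [t00|tn0] := eqVneq t 0; first by rewrite t00 invr0 mulr0 ler01.
by rewrite ler_pdivrMr ?mul1r// lt_neqAle eq_sym tn0.
Qed.

Lemma tanhR_sub_le t : `|tanhR t - t| <= t ^+ 2.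
Proof.
wlog t0 : t / 0 <= t.
  move=> H; have [/H//|/ltW t0] := leP 0 t.
  have := H (- t); rewrite oppr_ge0 => /(_ t0).
  by rewrite tanhR_opp -opprD normrN sqrrN.
have [h1 h2 h3] := tanhR_bounds t0.
by rewrite ler_norml; apply/andP; split; nra.
Qed.

Lemma tanhR_le_norm t : `|tanhR t| <= `|t|.
Proof.
have /andP[s0 s1] := tanh_slope01 t.
by rewrite tanh_slopeE normrM ger0_norm// ler_piMl.
Qed.

Lemma tanhR_le1 t : `|tanhR t| <= 1.
Proof.
rewrite ler_norml; have p := expR_gt0 t; have q := expR_gt0 (- t).
by rewrite /tanhR ler_pdivlMr// ler_pdivrMr//; apply/andP; split; lra.
Qed.

End Tanh.

(** * Stein identity for a single spin *)

Section Flip.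
Variables (R : realType) (N : nat).
Implicit Types (a c : 'I_N) (x : config N) (J : 'M[R]_N).

Definition flip a x : config N :=
  [ffun c => if c == a then ~~ x c else x c].

Lemma flipK a : involutive (flip a).
Proof.
by move=> x; apply/ffunP => c; rewrite !ffunE; case: eqP => // ->; rewrite negbK.
Qed.

Notation sp x a := (spin R x a ord0).

Lemma spin_sqr x a : sp x a * sp x a = 1.
Proof. by rewrite mxE; case: (x a) => /=; rewrite ?expr1 ?expr0; ring. Qed.

Lemma norm_spin x a : `|sp x a| = 1.
Proof. by rewrite mxE normrX normrN1 expr1n. Qed.

Lemma spin_flip a x c : sp (flip a x) c = (if c == a then -1 else 1) * sp x c.
Proof.
rewrite !mxE ffunE; case: eqP => [->|]; last by rewrite mul1r.
by case: (x a) => /=; rewrite ?expr1 ?expr0; ring.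
Qed.

(** The field acting on spin [a]: the self-interaction [J a a] drops out since
    it does not depend on the sign of that spin. *)
Definition cavity_field J a x : R := (J *m spin R x) a ord0 - J a a * sp x a.

Lemma cavity_field_flip J a x : cavity_field J a (flip a x) = cavity_field J a x.
Proof.
have fE y : cavity_field J a y = \sum_(c | c != a) J a c * sp y c.
  by rewrite /cavity_field mxE (bigD1 a)//= addrAC subrr add0r.
by rewrite !fE; apply: eq_bigr => c /negbTE ca; rewrite spin_flip ca mul1r.
Qed.

(** Flipping one spin changes the energy through its cavity field only. *)
Lemma quadform_flip J a x : J^T = J ->
  quadform J (spin R (flip a x)) =
  quadform J (spin R x) - 4 * (sp x a * cavity_field J a x).
Proof.
move=> Js; pose s := spin R x; pose e : 'cV[R]_N := delta_mx a ord0.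
pose c := - 2 * sp x a.
have -> : spin R (flip a x) = s + c *: e.
  apply/matrixP => i j; rewrite !ord1 spin_flip !mxE eqxx andbT.
  have [->|ia] := eqVneq i a; rewrite /c /s ?mxE /=; ring.
have h1 : (e^T *m J *m s) ord0 ord0 = (J *m s) a ord0.
  by rewrite /e trmx_delta -mulmxA -rowE mxE.
have h2 : (s^T *m J *m e) ord0 ord0 = (J *m s) a ord0.
  have -> : s^T *m J *m e = (e^T *m J *m s)^T by rewrite !trmx_mul trmxK Js mulmxA.
  by rewrite mxE.
have h3 : (e^T *m J *m e) ord0 ord0 = J a a.
  by rewrite /e trmx_delta -rowE -colE !mxE.
have tE : (s + c *: e)^T = s^T + c *: e^T by apply/matrixP => i j; rewrite !mxE.
rewrite /quadform tE !mulmxDl !mulmxDr -!scalemxAr -!scalemxAl.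
move: h1 h2 h3.
set A1 := e^T *m J *m s; set A2 := s^T *m J *m e; set A3 := e^T *m J *m e.
set A0 := s^T *m J *m s => h1 h2 h3.
rewrite /cavity_field -/s.
have mE (X Y : 'M[R]_1) : (X + Y) ord0 ord0 = X ord0 ord0 + Y ord0 ord0 by rewrite mxE.
have mZ z (X : 'M[R]_1) : (z *: X) ord0 ord0 = z * X ord0 ord0 by rewrite mxE.
rewrite ?(mE, mZ) h1 h2 h3.
have := spin_sqr x a; rewrite /c -/s; set sa := s a ord0; set Jsa := (_ *m _) _ _.
move=> sa2.
have -> : 4 * (sa * (Jsa - J a a * sa)) = 4 * sa * Jsa - 4 * J a a * (sa * sa) by ring.
have -> : - 2 * sa * (- 2 * sa * J a a) = 4 * J a a * (sa * sa) by ring.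
rewrite sa2; ring.
Qed.

Lemma partition_function_gt0 J : 0 < partition_function J.
Proof.
rewrite /partition_function.
have w0 x : 0 < ising_weight J x by exact: expR_gt0.
rewrite (bigD1 [ffun => true])//= ltr_wpDr// sumr_ge0// => x _; exact: ltW.
Qed.

Lemma ising_measure_ge0 J x : 0 <= ising_measure J x.
Proof. by rewrite divr_ge0// ltW ?expR_gt0 ?partition_function_gt0. Qed.

Lemma ising_measure_sum J : \sum_x ising_measure J x = 1.
Proof.
by rewrite -mulr_suml divff// gt_eqF// partition_function_gt0.
Qed.

Notation E J f := (\sum_(x : config N) ising_measure J x * f x).

Lemma ising_le J (f g : config N -> R) : (forall x, f x <= g x) -> E J f <= E J g.
Proof.
by move=> fg; apply: ler_sum => x _; rewrite ler_wpM2l ?ising_measure_ge0.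
Qed.

Lemma ising_norm_le J (f g : config N -> R) :
  (forall x, `|f x| <= g x) -> `|E J f| <= E J g.
Proof.
move=> fg; apply: le_trans (ler_norm_sum _ _ _) _; apply: ler_sum => x _.
by rewrite normrM ger0_norm ?ising_measure_ge0// ler_wpM2l ?ising_measure_ge0.
Qed.

Lemma ising_cst J (c : R) : E J (fun=> c) = c.
Proof. by rewrite -mulr_suml ising_measure_sum mul1r. Qed.

(** Given the other spins, spin [a] equals [+1] with odds [exp (2 theta)],
    hence its conditional mean is [tanhR theta]: the centred spin integrates to
    zero against every function of the other spins. *)
Lemma ising_cavity J a (G : config N -> R) : J^T = J ->
  (forall x, G (flip a x) = G x) ->
  E J (fun x => (sp x a - tanhR (cavity_field J a x)) * G x) = 0.
Proof.
move=> Js Ga; set S := LHS.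
suff : S + S = 0 by move=> SS; lra.
rewrite {1}/S (reindex_inj (inv_inj (flipK a)))/= /S -big_split/=.
apply: big1 => x _; rewrite Ga cavity_field_flip spin_flip eqxx.
set t := cavity_field J a x.
have -> : ising_measure J (flip a x)
        = ising_measure J x * (expR (- (sp x a * t)) / expR (sp x a * t)).
  rewrite /ising_measure /ising_weight quadform_flip// -/t mulrAC; congr (_ / _).
  rewrite -expRN -!expRD; congr expR.
  have : 2 * (2 : R)^-1 = 1 by rewrite divff.
  move: (_ ^-1) => h hh; have -> : h = 2^-1 by lra.
  by field.
have p := expR_gt0 t; have q := expR_gt0 (- t).
rewrite /tanhR mxE; case: (x a) => /=; rewrite ?expr1 ?expr0 ?mulN1r ?mul1r ?opprK;
  by field; rewrite ?gt_eqF// addr_gt0.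
Qed.

(** Half the change of [F] when spin [a] goes from [-1] to [+1]. *)
Definition spin_diff a (F : config N -> R) x := sp x a * (F x - F (flip a x)) / 2.

(** Splitting [F] into its part [F - x_a D_a F] that does not see spin [a] and
    the rest turns the cavity equation into an exact identity for every [F]. *)
Lemma ising_stein J a (F : config N -> R) : J^T = J ->
  E J (fun x => sp x a * F x) =
  E J (fun x => tanhR (cavity_field J a x) * F x
     + (1 - sp x a * tanhR (cavity_field J a x)) * spin_diff a F x).
Proof.
move=> Js; apply/eqP; rewrite -subr_eq0 -sumrB; apply/eqP.
rewrite -[RHS](@ising_cavity J a (fun x => (F x + F (flip a x)) / 2) Js); last first.
  by move=> x; rewrite flipK addrC.
apply: eq_bigr => x _; rewrite -mulrBr; congr (_ * _).
rewrite /spin_diff; set t := tanhR _; have := spin_sqr x a; set s := sp x a => ss.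
have -> : s * F x - (t * F x + (1 - s * t) * (s * (F x - F (flip a x)) / 2)) =
  s * F x - t * F x - s * (F x - F (flip a x)) / 2 + s * s * t * (F x - F (flip a x)) / 2.
  by field.
by rewrite ss; field.
Qed.

End Flip.

(** * Block magnetizations *)

Section BlockSpins.
Variables (R : realType) (k N : nat) (A : 'M[R]_k).
Variables (B : 'I_k -> {set 'I_N}) (b : 'I_N -> 'I_k).
Hypothesis N_gt0 : (0 < N)%N.
Hypothesis A_sym : A^T = A.
Hypothesis B_blocks : ordered_blocks B.
Hypothesis b_index : block_index B b.
Implicit Types (x : config N) (a c : 'I_N) (i j l : 'I_k) (F : config N -> R).

Notation sp x a := (spin R x a ord0).
Let J := block_interaction A b.
Notation E f := (\sum_(x : config N) ising_measure J x * f x).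

Definition block_size i : R := #|B i|%:R.
Definition block_eps i : R := (Num.sqrt (block_size i))^-1.
Definition block_ratio i : R := Num.sqrt (#|B i|%:R / N%:R).

(** The interaction seen by the rescaled magnetizations: the Hamiltonian equals
    [quadform mean_field m / 2]. *)
Definition mean_field : 'M[R]_k :=
  \matrix_(i, j) (block_ratio i * A i j * block_ratio j).

Notation m x i := (block_magnetization R B x i ord0).
Notation eps := block_eps.
Notation M := mean_field.
Notation Mm x i := (\sum_j M i j * m x j).

Lemma in_block a i : (a \in B i) = (b a == i).
Proof.
have [_ dis _ _] := B_blocks.
apply/idP/eqP => [ai|<-]; last exact: b_index.
apply/eqP/negPn/negP => ne; have := dis _ _ ne.
by move/setP/(_ a); rewrite !inE ai b_index.
Qed.

Lemma block_size_ge1 i : 1 <= block_size i.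
Proof. by have [/(_ i) ? _ _ _] := B_blocks; rewrite /block_size ler1n. Qed.

Let size_gt0 i : 0 < block_size i.
Proof. exact: lt_le_trans (block_size_ge1 i). Qed.

Lemma block_size_leN i : block_size i <= N%:R.
Proof. by rewrite /block_size ler_nat -[leqRHS]card_ord max_card. Qed.

Lemma block_eps_gt0 i : 0 < eps i.
Proof. by rewrite invr_gt0 sqrtr_gt0. Qed.

Lemma block_eps_sqr i : eps i * eps i = (block_size i)^-1.
Proof. by rewrite -expr2 exprVn sqr_sqrtr// ltW. Qed.

Lemma block_eps_le1 i : eps i <= 1.
Proof.
rewrite invf_le1 ?sqrtr_gt0// -[leLHS]sqrtr1 ler_sqrt//; exact: block_size_ge1.
Qed.

Lemma sum_block_cst i (z : R) : \sum_(a in B i) z = block_size i * z.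
Proof. by rewrite sumr_const mulr_natl. Qed.

Lemma magnetizationE x i : m x i = \sum_(a in B i) eps i * sp x a.
Proof. by rewrite mxE mulr_sumr. Qed.

Lemma magnetization_flip x a i :
  m (flip a x) i = m x i - 2 * sp x a * eps i * (b a == i)%:R.
Proof.
rewrite !magnetizationE; have [bai|nba] := eqVneq (b a) i; last first.
  rewrite mulr0 subr0; apply: eq_bigr => c cB; rewrite spin_flip.
  case: eqP => [ca|_]; last by rewrite mul1r.
  by move: cB; rewrite in_block ca (negbTE nba).
rewrite (bigD1 a) ?in_block ?bai//= [in RHS](bigD1 a) ?in_block ?bai//=.
rewrite spin_flip eqxx.
under eq_bigr => c /andP[_ /negbTE ca] do rewrite spin_flip ca mul1r.
by ring.
Qed.

Lemma block_interaction_sym : J^T = J.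
Proof.
apply/matrixP => a c; rewrite !mxE; congr (_ * _).
by rewrite -[in RHS]A_sym mxE.
Qed.

Let ratioE i : block_ratio i = Num.sqrt (block_size i) / Num.sqrt N%:R.
Proof. by rewrite /block_ratio sqrtrM ?ler0n// sqrtrV. Qed.

(** All spins of a block feel the same field, a function of the magnetizations:
    this is what makes the model mean-field. *)
Lemma total_fieldE x a : (J *m spin R x) a ord0 = eps (b a) * Mm x (b a).
Proof.
rewrite mxE (partition_big b predT)//= mulr_sumr; apply: eq_bigr => j _.
rewrite magnetizationE mxE !mulr_sumr.
rewrite (eq_bigl (fun c => c \in B j)); last by move=> c; rewrite in_block.
apply: eq_bigr => c; rewrite in_block => /eqP bc.
rewrite mxE bc !ratioE /block_eps.
have s1 i : Num.sqrt (block_size i) != 0 by rewrite gt_eqF// sqrtr_gt0.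
have N0 : 0 < N%:R :> R by rewrite ltr0n.
have s2 : Num.sqrt N%:R != 0 :> R by rewrite gt_eqF// sqrtr_gt0.
rewrite -[in LHS](sqr_sqrtr (ltW N0)).
by field; rewrite ?s1 ?s2.
Qed.

Lemma cavity_fieldE x a : cavity_field J a x =
  eps (b a) * Mm x (b a) - N%:R^-1 * A (b a) (b a) * sp x a.
Proof. by rewrite /cavity_field total_fieldE mxE. Qed.

(** The single-spin identity, summed over a block with the weight that turns
    spins into magnetizations. *)
Definition block_stein_op i F x := \sum_(a in B i) eps i *
  (tanhR (cavity_field J a x) * F x
   + (1 - sp x a * tanhR (cavity_field J a x)) * spin_diff a F x).

Lemma block_stein i F :
  E (fun x => m x i * F x) = E (block_stein_op i F).
Proof.
under eq_bigr do rewrite magnetizationE mulr_suml mulr_sumr.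
under [RHS]eq_bigr do rewrite mulr_sumr.
rewrite exchange_big [RHS]exchange_big/=; apply: eq_bigr => a _.
have := ising_stein a F block_interaction_sym => H.
under eq_bigr do rewrite -mulrA mulrCA.
under [RHS]eq_bigr do rewrite mulrCA.
by rewrite -!mulr_sumr H.
Qed.

Definition magnetization_sqr x : R := \sum_i m x i ^+ 2.
Notation phi := magnetization_sqr.

Lemma magnetization_sqr_ge0 x : 0 <= phi x.
Proof. by apply: sumr_ge0 => i _; exact: sqr_ge0. Qed.

Lemma le_magnetization_sqr x i : m x i ^+ 2 <= phi x.
Proof.
by rewrite /phi (bigD1 i)//= lerDl sumr_ge0// => j _; exact: sqr_ge0.
Qed.

Let le_1Dsqr (u v : R) : u ^+ 2 <= v -> `|u| <= 1 + v.
Proof. by move=> uv; rewrite ler_norml; apply/andP; split; nra. Qed.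

Lemma norm_magnetization_le x i : `|m x i| <= 1 + phi x.
Proof. exact/le_1Dsqr/le_magnetization_sqr. Qed.

Variables (q amax : R).
Hypothesis q_gt0 : 0 < q.
Hypothesis q_lt1 : q < 1.
Hypothesis A_le : forall i j, `|A i j| <= amax.
Hypothesis M_contr : forall v : 'I_k -> R,
  \sum_i (\sum_j M i j * v j) ^+ 2 <= q ^+ 2 * \sum_i v i ^+ 2.

Let invN_le i : N%:R^-1 <= eps i * eps i.
Proof.
rewrite block_eps_sqr lef_pV2; [|by rewrite posrE ltr0n|by rewrite posrE].
exact: block_size_leN.
Qed.

Let amax_ge0 i : 0 <= amax.
Proof. exact: le_trans (normr_ge0 _) (A_le i i). Qed.

Let self_le i x a : `|N%:R^-1 * A i i * sp x a| <= amax * (eps i * eps i).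
Proof.
rewrite !normrM norm_spin mulr1 mulrC [`|N%:R^-1|]ger0_norm ?invr_ge0 ?ler0n//.
by apply: ler_pM; rewrite ?invr_ge0 ?ler0n// invN_le.
Qed.

Lemma sum_mean_field_le x : \sum_i Mm x i ^+ 2 <= q ^+ 2 * phi x.
Proof. exact: (M_contr (fun j => m x j)). Qed.

Lemma mean_field_sqr_le x i : Mm x i ^+ 2 <= phi x.
Proof.
have h : Mm x i ^+ 2 <= \sum_i Mm x i ^+ 2.
  by rewrite [leRHS](bigD1 i)//= lerDl sumr_ge0// => j _; exact: sqr_ge0.
apply: le_trans h (le_trans (sum_mean_field_le x) _).
by rewrite ler_piMl ?magnetization_sqr_ge0// expr_le1// ltW.
Qed.

(** * Fourth moments *)

(** The test functions for the fourth moment: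
    [phi ^ 2 = sum_i m_i (m_i phi)]. *)
Let quartic i x := m x i * phi x.

Let phi_flip x a : phi (flip a x) =
  phi x - 4 * sp x a * eps (b a) * m x (b a) + 4 * (eps (b a) * eps (b a)).
Proof.
rewrite /phi (bigD1 (b a))//= [in RHS](bigD1 (b a))//=.
rewrite magnetization_flip eqxx mulr1.
under eq_bigr => j /negbTE ne do rewrite magnetization_flip eq_sym ne mulr0 subr0.
have ss := spin_sqr R x a.
set s := sp x a in ss *; set e := eps _; set u := m x _; set S := \sum_(_ < _ | _) _.
have -> : (u - 2 * s * e) ^+ 2 = u ^+ 2 - 4 * s * e * u + 4 * (s * s) * (e * e) by ring.
by rewrite ss; ring.
Qed.

Let diff_quartic x a i : a \in B i ->
  `|spin_diff a (quartic i) x| <= eps i * (6 * phi x + 7).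
Proof.
rewrite in_block => /eqP <-; rewrite /spin_diff /quartic phi_flip magnetization_flip.
rewrite eqxx mulr1 !normrM norm_spin mul1r [`|2^-1|]ger0_norm ?invr_ge0 ?ler0n//.
have ss := spin_sqr R x a.
have u2 := le_magnetization_sqr x (b a).
have e0 := block_eps_gt0 (b a); have e1 := block_eps_le1 (b a).
have p0 := magnetization_sqr_ge0 x.
set s := sp x a in ss *; set e := eps _ in e0 e1 *; set u := m x _ in u2 *.
set p := phi x in u2 p0 *.
rewrite ler_pdivrMr ?ltr0n//.
pose d := - (2 * s * e).
have -> : u * p - (u - 2 * s * e) * (p - 4 * s * e * u + 4 * (e * e)) =
    - (d * (p + 2 * u ^+ 2 + 3 * u * d + d ^+ 2)) + 4 * (s * s - 1) * (u - 2 * s * e) * (e * e).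
  by rewrite /d; ring.
rewrite ss subrr mulr0 !mul0r addr0 normrN normrM.
have dE : `|d| = 2 * e by rewrite /d normrN !normrM norm_spin mulr1 !ger0_norm// ltW.
have -> : e * (6 * p + 7) * 2 = 2 * e * (6 * p + 7) by ring.
rewrite dE ler_pM2l; last by rewrite mulr_gt0.
have [d1 d2] : - (2 * e) <= d /\ d <= 2 * e by apply/andP; rewrite -ler_norml dE.
have d4 : d ^+ 2 <= 4 by nra.
have ud1 : u * d <= 1 + u ^+ 2 by have := sqr_ge0 (u - d / 2); nra.
have ud2 : - (u * d) <= 1 + u ^+ 2 by have := sqr_ge0 (u + d / 2); nra.
by have := sqr_ge0 u; have := sqr_ge0 d; rewrite ler_norml; lra.
Qed.

(** Through [tanh t = slope t] the drift is the average slope over the block times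
    the mean field, up to the self-interaction removed from the cavity field. Any
    average slope in [0, 1] is good enough for moment bounds. *)
Let drift_split i F x : exists2 w : R, 0 <= w <= 1 &
  `|\sum_(a in B i) eps i * (tanhR (cavity_field J a x) * F x) - w * Mm x i * F x|
    <= amax * `|F x|.
Proof.
pose sl a := tanh_slope (cavity_field J a x).
have sl01 a : 0 <= sl a <= 1 by exact: tanh_slope01.
have e0 := block_eps_gt0 i.
exists (\sum_(a in B i) eps i * eps i * sl a).
  rewrite sumr_ge0/=; last first.
    by move=> a _; have /andP[s0 _] := sl01 a; apply: mulr_ge0 => //; apply: mulr_ge0; exact: ltW.
  rewrite -(@divff _ (block_size i)) ?gt_eqF// -block_eps_sqr -sum_block_cst.
  by apply: ler_sum => a _; have /andP[_ s1] := sl01 a; apply: ler_piMr => //; apply: mulr_ge0; exact: ltW.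
rewrite mulr_suml mulr_suml -sumrB.
have -> : amax * `|F x| = \sum_(a in B i) (eps i * eps i) * (amax * `|F x|).
  by rewrite sum_block_cst mulrA block_eps_sqr divff ?mul1r// gt_eqF.
apply: le_trans (ler_norm_sum _ _ _) _; apply: ler_sum => a aB.
move: (aB); rewrite in_block => /eqP bai.
rewrite tanh_slopeE -/(sl a) cavity_fieldE bai.
set c := _ * A i i * _; set h := Mm x i.
have -> : eps i * (sl a * (eps i * h - c) * F x) - eps i * eps i * sl a * h * F x
  = - (eps i * sl a * c * F x) by ring.
rewrite normrN normrM [leRHS]mulrA ler_wpM2r// normrM.
have -> : eps i * eps i * amax = 1 * (amax * (eps i * eps i)) by ring.
apply: ler_pM => //; last exact: self_le.
have /andP[] := sl01 a; move: (sl a) => z z0 z1.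
rewrite ger0_norm ?mulr_ge0 ?(ltW e0)//.
by rewrite -[leRHS]mul1r ler_pM ?(ltW e0)// block_eps_le1.
Qed.

Let diff_split i F x (D : R) : (forall a, a \in B i -> `|spin_diff a F x| <= eps i * D) ->
  `|\sum_(a in B i) eps i * ((1 - sp x a * tanhR (cavity_field J a x)) * spin_diff a F x)|
    <= 2 * D.
Proof.
move=> FD; have e0 := block_eps_gt0 i.
have -> : 2 * D = \sum_(a in B i) (eps i * (2 * (eps i * D))).
  rewrite sum_block_cst.
  have -> : block_size i * (eps i * (2 * (eps i * D))) =
    block_size i * (eps i * eps i) * (2 * D) by ring.
  by rewrite block_eps_sqr divff ?mul1r// gt_eqF.
apply: le_trans (ler_norm_sum _ _ _) _; apply: ler_sum => a aB.
rewrite normrM (gtr0_norm e0) ler_wpM2l ?(ltW e0)// normrM ler_pM// ?FD//.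
apply: le_trans (ler_normB _ _) _; rewrite normr1 normrM norm_spin mul1r.
by have := tanhR_le1 (cavity_field J a x); lra.
Qed.

Let stein_split i F x : block_stein_op i F x =
  \sum_(a in B i) eps i * (tanhR (cavity_field J a x) * F x) +
  \sum_(a in B i) eps i * ((1 - sp x a * tanhR (cavity_field J a x)) * spin_diff a F x).
Proof. by rewrite -big_split/=; apply: eq_bigr => a _; rewrite mulrDr. Qed.

(** [q + 2 moment_gap] lies halfway between [q] and [1]. *)
Definition moment_gap : R := (1 - q) / 4.
Definition moment_lin : R := k%:R * (amax ^+ 2 / (4 * moment_gap)) + 12 * k%:R.
Definition fourth_moment_bound : R :=
  (moment_lin ^+ 2 / (4 * moment_gap) + 14 * k%:R) / (2 * moment_gap).

Let gap_gt0 : 0 < moment_gap.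
Proof. by rewrite divr_gt0 ?subr_gt0. Qed.

Let am_gm (u v d : R) : 0 < d -> u * v <= d * v ^+ 2 + u ^+ 2 / (4 * d).
Proof.
move=> d0; rewrite -subr_ge0.
have -> : d * v ^+ 2 + u ^+ 2 / (4 * d) - u * v = (2 * d * v - u) ^+ 2 / (4 * d).
  by field; rewrite gt_eqF.
by rewrite divr_ge0 ?sqr_ge0// mulr_ge0// ltW.
Qed.

(** The drift is at most [q phi ^ 2] by contraction. The terms of lower order
    are absorbed into [2 moment_gap phi ^ 2] by two uses of Young's inequality. *)
Let stein_quartic_le x : \sum_i block_stein_op i (quartic i) x <=
  (q + 2 * moment_gap) * phi x ^+ 2 +
  (moment_lin ^+ 2 / (4 * moment_gap) + 14 * k%:R).
Proof.
set d := moment_gap; set p := phi x.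
have p0 : 0 <= p := magnetization_sqr_ge0 x.
have step i : block_stein_op i (quartic i) x <=
    (q * m x i ^+ 2 + Mm x i ^+ 2 / q) / 2 * p
    + (d * m x i ^+ 2 + amax ^+ 2 / (4 * d)) * p + 2 * (6 * p + 7).
  have [w /andP[w0 w1] H1] := drift_split i (quartic i) x.
  have H2 := diff_split (fun a (aB : a \in B i) => diff_quartic x aB).
  rewrite stein_split; apply: lerD; last exact: le_trans (ler_norm _) H2.
  move: H1; set S := \sum_(_ in _) _; set u := m x i; set h := Mm x i.
  have -> : quartic i x = u * p by [].
  move=> H1.
  have {}H1 : S <= w * h * (u * p) + amax * `|u * p|.
    by rewrite -lerBlDl (le_trans (ler_norm _) H1).
  apply: le_trans H1 _; apply: lerD.
    rewrite mulrA ler_wpM2r//.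
    have q2 : (q * u ^+ 2 + h ^+ 2 / q) / 2 - w * h * u =
       (1 - w) * ((q * u ^+ 2 + h ^+ 2 / q) / 2) + w * ((q * u - h) ^+ 2 / (2 * q)).
      by field; rewrite gt_eqF.
    rewrite -subr_ge0 q2 addr_ge0// mulr_ge0 ?subr_ge0//.
      have q0 := ltW q_gt0.
      apply: divr_ge0 => //; apply: addr_ge0; [apply: mulr_ge0|apply: divr_ge0] => //;
        exact: sqr_ge0.
    by rewrite divr_ge0 ?sqr_ge0// mulr_ge0// ltW.
  rewrite normrM (ger0_norm p0) mulrA.
  apply: ler_wpM2r; first exact: p0.
  have -> : u ^+ 2 = `|u| ^+ 2 by rewrite real_normK ?num_real.
  exact: (@am_gm amax `|u| d gap_gt0).
have {}step : \sum_i block_stein_op i (quartic i) x <= _ := ler_sum _ (fun i _ => step i).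
apply: le_trans step _; rewrite 2!big_split /= -2!mulr_suml -mulr_suml 2!big_split /=.
rewrite -2!mulr_sumr -mulr_suml !sumr_const !card_ord -[\sum_(i < k) m x i ^+ 2]/(phi x) -/p.
have Mp := sum_mean_field_le x; rewrite -/p in Mp.
have {}Mp : (\sum_i Mm x i ^+ 2) / q <= q * p.
  by rewrite ler_pdivrMr//; apply: le_trans Mp _; rewrite expr2; lra.
have := am_gm moment_lin p gap_gt0; rewrite -/d.
have natE (z : R) : z *+ k = k%:R * z by rewrite mulr_natl.
rewrite (natE (amax ^+ 2 / (4 * d))) (natE (2 * (6 * p + 7))).
have := ler_wpM2r p0 Mp.
have : moment_lin = k%:R * (amax ^+ 2 / (4 * d)) + 12 * k%:R by [].
set z := amax ^+ 2 / _; set y := moment_lin ^+ 2 / _; set S := _ / q.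
clearbody z y S d p; move: (moment_lin) (k%:R : R) => l K -> h1 h2.
by lra.
Qed.

(** The contraction [q < 1] lets the drift term be absorbed into the left-hand
    side; all other terms are of lower order in [phi]. *)
Lemma fourth_moment_le : E (fun x => phi x ^+ 2) <= fourth_moment_bound.
Proof.
set X := E _; rewrite /fourth_moment_bound ler_pdivlMr; last by apply: mulr_gt0.
pose c := moment_lin ^+ 2 / (4 * moment_gap) + 14 * k%:R.
have XE : E (fun x => phi x ^+ 2) = E (fun x => \sum_i block_stein_op i (quartic i) x).
  under [RHS]eq_bigr do rewrite mulr_sumr.
  rewrite exchange_big/=; under [RHS]eq_bigr do rewrite -block_stein.
  rewrite exchange_big/=; apply: eq_bigr => x _; rewrite -mulr_sumr; congr (_ * _).
  rewrite expr2 {1}/phi mulr_suml; apply: eq_bigr => i _.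
  by rewrite /quartic expr2 mulrA.
have : X <= E (fun x => (q + 2 * moment_gap) * phi x ^+ 2 + c).
  by rewrite /X XE; apply: ising_le => x; exact: stein_quartic_le.
rewrite -/c; under eq_bigr do rewrite mulrDr mulrCA.
rewrite big_split/= -mulr_sumr ising_cst -/X.
have : q = 1 - 4 * moment_gap by rewrite /moment_gap; field.
by move: c X moment_gap => c X g -> ; lra.
Qed.

(** * Approximate Stein identity *)

Notation beta x := (1 + phi x).

Definition stein_const : R := amax + 2 * (1 + amax ^+ 2) + 2 + 3 * (1 + amax).

(** [D] plays the part of the partial derivative of [F] along the [i]-th
    magnetization, up to a second-order error of size [L]. *)
Definition smooth_along (i : 'I_k) (L : R) F (D : config N -> R) :=
  [/\ forall x, `|F x| <= L * beta x, forall x, `|D x| <= L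
    & forall x a, a \in B i ->
      `|F (flip a x) - F x + 2 * sp x a * eps i * D x| <= 4 * L * (eps i * eps i)].

(** One spin [s] of a block, with [e] the weight of the block, [h] its mean field, [c]
    the self-interaction, [f] and [g] the values of [F] before and after the flip,
    and [t] the hyperbolic tangent of [e h - c]. Every replacement, of [t] by [e h]
    and of the finite difference by [e D], costs [e ^ 2]. *)
Let stein_term_aux (K L s e c h p f g D t : R) :
  0 <= K -> 0 <= L -> s * s = 1 -> `|s| = 1 -> 0 < e -> e <= 1 ->
  `|c| <= K * (e * e) -> h ^+ 2 <= p -> `|f| <= L * (1 + p) -> `|D| <= L ->
  `|t - (e * h - c)| <= (e * h - c) ^+ 2 -> `|t| <= `|e * h - c| ->
  `|g - f + 2 * s * e * D| <= 4 * L * (e * e) ->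
  `|(t * f + (1 - s * t) * (s * (f - g) / 2)) - e * (h * f + D)|
    <= e * e * ((K + 2 * (1 + K ^+ 2) + 2 + 3 * (1 + K)) * L * (1 + p) ^+ 2).
Proof.
move=> K0 L0 ss s1 e0 e1 cK hp fL DL tE tL FD.
set d := s * (f - g) / 2; set y := 1 + p; set th := e * h - c in tE tL *.
have y1 : 1 <= y by rewrite /y; have := sqr_ge0 h; lra.
have y0 : 0 <= y by lra.
have ee0 : 0 <= e * e by rewrite mulr_ge0 ?ltW.
have ee1 : e * e <= 1 by nra.
have yy : y <= y ^+ 2 by rewrite expr2 ler_peMl.
have yy1 : 1 <= y ^+ 2 by lra.
have LE : 0 <= e * e * L by rewrite mulr_ge0.
have dD : `|d - e * D| <= 2 * (e * e * L).
  have -> : d - e * D = - (s / 2) * (g - f + 2 * s * e * D) + (s * s - 1) * (e * D).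
    by rewrite /d; field.
  rewrite ss subrr mul0r addr0 normrM normrN normrM s1 mul1r ger0_norm//.
  by move: FD; set z := `|_|; lra.
have d3 : `|d| <= 3 * (e * L).
  have -> : d = (d - e * D) + e * D by ring.
  apply: le_trans (ler_normD _ _) _; rewrite [`|e * D|]normrM (gtr0_norm e0).
  have h1 := ler_wpM2l (ltW e0) DL.
  have h2 : e * e * L <= e * L.
    by rewrite ler_wpM2r// ler_piMl// ltW.
  by lra.
have th2 : th ^+ 2 <= 2 * (1 + K ^+ 2) * (e * e) * y.
  have h1 : th ^+ 2 <= 2 * (e * e) * h ^+ 2 + 2 * c ^+ 2.
    by rewrite /th; have := sqr_ge0 (e * h + c); lra.
  have h2 : c ^+ 2 <= K ^+ 2 * (e * e).
    rewrite -real_normK ?num_real//.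
    apply: (@le_trans _ _ ((K * (e * e)) ^+ 2)).
      by apply: lerXn2r; rewrite ?nnegrE //; exact: mulr_ge0.
    by rewrite exprMn ler_wpM2l ?sqr_ge0// expr2 ler_piMl.
  have h3 := ler_wpM2l ee0 hp.
  have h4 : 0 <= e * e * p by apply: mulr_ge0 => //; rewrite /y in y1; lra.
  have h5 : 0 <= K ^+ 2 * (e * e * p) by apply: mulr_ge0 => //; exact: sqr_ge0.
  by rewrite /y; lra.
have thn : `|th| <= e * (1 + K) * y.
  have hy : `|h| <= y by rewrite /y; exact: le_1Dsqr.
  apply: le_trans (ler_normB _ _) _; rewrite normrM (gtr0_norm e0).
  have h1 := ler_wpM2l (ltW e0) hy.
  have h2 : K * (e * e) <= e * K * y.
    rewrite mulrA [K * e]mulrC ler_wpM2l ?mulr_ge0 ?(ltW e0)//; lra.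
  by lra.
have -> : t * f + (1 - s * t) * d - e * (h * f + D) =
   (t - th) * f - c * f + (d - e * D) - s * t * d by rewrite /th; ring.
have b1 : `|(t - th) * f| <= e * e * L * (2 * (1 + K ^+ 2) * y ^+ 2).
  rewrite normrM.
  have -> : e * e * L * (2 * (1 + K ^+ 2) * y ^+ 2) =
    (2 * (1 + K ^+ 2) * (e * e) * y) * (L * y) by ring.
  by apply: ler_pM => //; exact: le_trans tE th2.
have b2 : `|c * f| <= e * e * L * (K * y ^+ 2).
  rewrite normrM.
  have -> : e * e * L * (K * y ^+ 2) = (K * (e * e)) * (L * y ^+ 2) by ring.
  by apply: ler_pM => //; apply: le_trans fL _; exact: ler_wpM2l.
have b3 : `|d - e * D| <= e * e * L * (2 * y ^+ 2).
  by apply: le_trans dD _; rewrite [leRHS]mulrCA ler_wpM2l// ler_peMr.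
have b4 : `|s * t * d| <= e * e * L * (3 * (1 + K) * y ^+ 2).
  rewrite [`|s * t * d|]normrM [`|s * t|]normrM s1 mul1r.
  have -> : e * e * L * (3 * (1 + K) * y ^+ 2) =
    (e * (1 + K) * y ^+ 2) * (3 * (e * L)) by ring.
  apply: ler_pM => //; apply: le_trans tL (le_trans thn _).
  by apply: ler_wpM2l => //; rewrite mulr_ge0 ?(ltW e0)// addr_ge0.
apply: le_trans (ler_normB _ _) _; apply: le_trans (lerD (ler_normD _ _) (lexx _)) _.
apply: le_trans (lerD (lerD (ler_normB _ _) (lexx _)) (lexx _)) _.
move: b1 b2 b3 b4; set n1 := `|_|; set n2 := `|_|; set n3 := `|_|; set n4 := `|_|.
lra.
Qed.

Let stein_term i L F D x a : smooth_along i L F D -> a \in B i ->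
  `|eps i * (tanhR (cavity_field J a x) * F x
      + (1 - sp x a * tanhR (cavity_field J a x)) * spin_diff a F x)
    - eps i * eps i * (Mm x i * F x + D x)|
  <= eps i * (eps i * eps i * (stein_const * L * beta x ^+ 2)).
Proof.
move=> [FL DL FD] aB; have bai : b a = i by apply/eqP; rewrite -in_block.
have e0 := block_eps_gt0 i.
rewrite -mulrA -mulrBr normrM (gtr0_norm e0) ler_pM2l//.
have L0 : 0 <= L := le_trans (normr_ge0 _) (DL x).
have tE := tanhR_sub_le (cavity_field J a x).
have tL := tanhR_le_norm (cavity_field J a x).
apply: (@stein_term_aux amax L (sp x a) (eps i) (N%:R^-1 * A i i * sp x a)) => //;
  rewrite -1?[X in eps _ * _ - X]/(N%:R^-1 * A i i * sp x a).
- exact: amax_ge0 i.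
- exact: spin_sqr.
- exact: norm_spin.
- exact: block_eps_le1.
- exact: mean_field_sqr_le.
- by move: tE; rewrite {2 3}cavity_fieldE bai.
- by move: tL; rewrite {2}cavity_fieldE bai.
- exact: FD.
Qed.

(** A block has [eps_i ^ (- 2)] spins, each contributing an error [eps_i ^ 3]: what
    remains is [eps_i], of order [N ^ (- 1/2)]. *)
Lemma approx_stein i L F D : smooth_along i L F D ->
  `|E (fun x => m x i * F x) - E (fun x => Mm x i * F x) - E D|
    <= stein_const * L * eps i * (2 + 2 * fourth_moment_bound).
Proof.
move=> FD; rewrite block_stein -!sumrB.
under eq_bigr do rewrite -!mulrBr.
apply: (@le_trans _ _ (E (fun x => eps i * (stein_const * L * beta x ^+ 2)))).
  apply: ising_norm_le => x.
  have -> : block_stein_op i F x - Mm x i * F x - D x = \sum_(a in B i)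
    (eps i * (tanhR (cavity_field J a x) * F x
      + (1 - sp x a * tanhR (cavity_field J a x)) * spin_diff a F x)
    - eps i * eps i * (Mm x i * F x + D x)).
    rewrite sumrB sum_block_cst mulrA block_eps_sqr divff ?mul1r ?gt_eqF//.
    by rewrite opprD addrA.
  apply: le_trans (ler_norm_sum _ _ _) _.
  apply: (@le_trans _ _ (\sum_(a in B i)
      eps i * (eps i * eps i * (stein_const * L * beta x ^+ 2)))).
    by apply: ler_sum => a aB; exact: stein_term.
  rewrite sum_block_cst; set z := _ * beta x ^+ 2.
  have -> : block_size i * (eps i * (eps i * eps i * z)) =
    block_size i * (eps i * eps i) * (eps i * z) by ring.
  by rewrite block_eps_sqr divff ?mul1r// gt_eqF.
rewrite -[X in _ <= X * _]mulrC mulrAC.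
have SL0 : 0 <= eps i * (stein_const * L).
  have [_ /(_ [ffun=> true]) DL _] := FD.
  have L0 := le_trans (normr_ge0 _) DL; have A0 := amax_ge0 i.
  rewrite mulr_ge0 ?(ltW (block_eps_gt0 i))// mulr_ge0//.
  by rewrite /stein_const; have := sqr_ge0 amax; lra.
apply: (@le_trans _ _ (E (fun x => eps i * (stein_const * L) * (2 + 2 * phi x ^+ 2)))).
  apply: ising_le => x; rewrite mulrA; apply: ler_wpM2l => //.
  by have := sqr_ge0 (phi x - 1); lra.
under eq_bigr do rewrite mulrCA mulrDr [_ * (2 * _)]mulrCA.
rewrite -mulr_sumr big_split/= ising_cst -mulr_sumr.
rewrite [leRHS]mulrAC; apply: ler_wpM2l => //.
by have := fourth_moment_le; lra.
Qed.

(** * Stein identity with the covariance *)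

Lemma covarianceE j l :
  magnetization_covariance J B j l = E (fun x => m x j * m x l).
Proof.
rewrite /magnetization_covariance /ising_expectation summxE.
by apply: eq_bigr => x _; rewrite !mxE big_ord1 !mxE.
Qed.

Let smooth_coordinate i l : smooth_along i 1 (fun x => m x l) (fun=> (i == l)%:R).
Proof.
split=> [x|x|x a].
- by rewrite mul1r norm_magnetization_le.
- by case: (i == l); rewrite ?normr1 ?normr0.
rewrite in_block => /eqP bai; rewrite magnetization_flip bai.
have -> : m x l - 2 * sp x a * eps l * (i == l)%:R - m x l +
    2 * sp x a * eps i * (i == l)%:R = 0.
  by case: eqP => [->|_]; rewrite ?mulr1n ?mulr0n; ring.
by rewrite normr0; apply: mulr_ge0; [lra|apply: mulr_ge0; exact/ltW/block_eps_gt0].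
Qed.

Definition cov_stein_const : R :=
  k%:R * ((1 + k%:R) * (stein_const * (2 + 2 * fourth_moment_bound))) / (1 - q).

Let fourth_ge0 : 0 <= fourth_moment_bound.
Proof.
apply: le_trans fourth_moment_le.
by apply: sumr_ge0 => x _; apply: mulr_ge0; rewrite ?ising_measure_ge0 ?sqr_ge0.
Qed.

(** With [W = 1 - M], the covariance satisfies [W Sigma = 1] up to the error of
    the approximate Stein identity. Hence [y_j = E [m_j F] - sum_l Sigma_jl E [D_l]]
    has [W y] small, and [|y| <= |W y| / (1 - q)] since [M] contracts by [q]. *)
Lemma cov_stein (eta L : R) F (D : 'I_k -> config N -> R) j :
  (forall i, eps i <= eta) -> (forall i, smooth_along i L F (D i)) ->
  `|E (fun x => m x j * F x)
    - \sum_l magnetization_covariance J B j l * E (D l)| <= cov_stein_const * L * eta.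
Proof.
move=> eta_ge FD.
pose S i l := E (fun x => m x i * m x l).
pose y i := E (fun x => m x i * F x) - \sum_l S i l * E (D l).
pose C := stein_const * (2 + 2 * fourth_moment_bound).
have A0 := amax_ge0 j; have eta0 : 0 <= eta := le_trans (ltW (block_eps_gt0 j)) (eta_ge j).
have L0 : 0 <= L by have [_ /(_ [ffun=> true]) DL _] := FD j; exact: le_trans DL.
have C0 : 0 <= C.
  apply: mulr_ge0; last by rewrite addr_ge0// mulr_ge0.
  by rewrite /stein_const; have := sqr_ge0 amax; lra.
have approx i L' F' D' : smooth_along i L' F' D' ->
  `|E (fun x => m x i * F' x) - E (fun x => Mm x i * F' x) - E D'| <= C * L' * eta.
  move=> FD'; apply: le_trans (approx_stein FD') _.
  have L'0 : 0 <= L' by have [_ /(_ [ffun=> true]) DL _] := FD'; exact: le_trans DL.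
  have -> : stein_const * L' * eps i * (2 + 2 * fourth_moment_bound) =
    C * L' * eps i by rewrite /C; ring.
  by rewrite ler_wpM2l// mulr_ge0.
pose r := C * L * eta * (1 + k%:R).
have Wy i : `|y i - \sum_j M i j * y j| <= r.
  have -> : y i - \sum_j M i j * y j =
     (E (fun x => m x i * F x) - E (fun x => Mm x i * F x) - E (D i))
     - \sum_l (S i l - E (fun x => Mm x i * m x l) - E (fun=> (i == l)%:R)) * E (D l).
    have mf (G : config N -> R) : E (fun x => Mm x i * G x) =
        \sum_j M i j * E (fun x => m x j * G x).
      under eq_bigr do rewrite mulr_suml mulr_sumr.
      rewrite exchange_big/=; apply: eq_bigr => c _; rewrite mulr_sumr.
      by apply: eq_bigr => x _; ring.
    have -> : \sum_l (S i l - E (fun x => Mm x i * m x l) - E (fun=> (i == l)%:R)) * E (D l)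
      = \sum_l S i l * E (D l) - \sum_l (\sum_j M i j * S j l) * E (D l) - E (D i).
      under eq_bigr do rewrite mf ising_cst !mulrBl.
      rewrite !sumrB; congr (_ - _); rewrite (bigD1 i)//= eqxx mul1r [X in _ + X]big1 ?addr0//.
      by move=> l li; rewrite eq_sym (negbTE li) mul0r.
    rewrite mf /y; under [X in _ - X = _]eq_bigr do rewrite mulrBr.
    rewrite sumrB.
    have -> : \sum_l (\sum_j M i j * S j l) * E (D l) =
      \sum_j M i j * (\sum_l S j l * E (D l)).
      under eq_bigr do rewrite mulr_suml.
      rewrite exchange_big/=; apply: eq_bigr => c _; rewrite mulr_sumr.
      by apply: eq_bigr => l _; rewrite mulrA.
    by ring.
  apply: le_trans (ler_normB _ _) _; rewrite /r mulrDr mulr1; apply: lerD; first exact: approx.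
  apply: le_trans (ler_norm_sum _ _ _) _.
  have -> : C * L * eta * k%:R = \sum_(l < k) C * eta * L.
    by rewrite sumr_const card_ord -mulr_natr; ring.
  apply: ler_sum => l _; rewrite normrM; apply: ler_pM => //.
    by have := approx _ _ _ _ (smooth_coordinate i l); rewrite mulr1.
  have [_ DL _] := FD l; rewrite -[leRHS](ising_cst J).
  exact: ising_norm_le.
have r0 : 0 <= r := le_trans (normr_ge0 _) (Wy j).
have My := M_contr y.
(* Convexity of the square: (u + w)^2 <= u^2 / (1 - q) + w^2 / q. *)
have split i : y i ^+ 2 <= r ^+ 2 / (1 - q) + (\sum_j M i j * y j) ^+ 2 / q.
  have := Wy i; set w := \sum_j _ => zr.
  have q1 : 0 < 1 - q by rewrite subr_gt0.
  have z2 : (y i - w) ^+ 2 <= r ^+ 2.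
    by rewrite -real_normK ?num_real//; apply: lerXn2r; rewrite ?nnegrE.
  have h : y i ^+ 2 <= (y i - w) ^+ 2 / (1 - q) + w ^+ 2 / q.
    rewrite -subr_ge0.
    have -> : (y i - w) ^+ 2 / (1 - q) + w ^+ 2 / q - y i ^+ 2 =
       (q * (y i - w) - (1 - q) * w) ^+ 2 / ((1 - q) * q).
      by field; rewrite !gt_eqF.
    by rewrite divr_ge0 ?sqr_ge0// mulr_ge0 ?ltW.
  by apply: le_trans h _; rewrite lerD2r ler_wpM2r// invr_ge0 ltW.
have tot : (1 - q) * \sum_i y i ^+ 2 <= k%:R * (r ^+ 2 / (1 - q)).
  have : \sum_i y i ^+ 2 <= \sum_i _ := ler_sum _ (fun i _ => split i).
  have natE (z : R) : z *+ k = k%:R * z by rewrite mulr_natl.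
  rewrite big_split/= sumr_const card_ord natE -mulr_suml.
  have : (\sum_i (\sum_j M i j * y j) ^+ 2) / q <= q * \sum_i y i ^+ 2.
    by rewrite ler_pdivrMr//; apply: le_trans My _; rewrite expr2; lra.
  set a1 := _ / q; set a2 := \sum_i y i ^+ 2; set a3 := k%:R * _; lra.
have k1 : 1 <= k%:R :> R by rewrite ler1n; apply: leq_ltn_trans (ltn_ord j).
have q1 : 0 < 1 - q by rewrite subr_gt0.
under [X in _ - X]eq_bigr do rewrite covarianceE.
rewrite -/(y j).
have -> : cov_stein_const * L * eta = k%:R * r / (1 - q).
  by rewrite /cov_stein_const -/C /r; field; rewrite gt_eqF.
have r1 : 0 <= k%:R * r / (1 - q).
  by apply: divr_ge0; [apply: mulr_ge0; rewrite ?ler0n|exact: ltW].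
rewrite -(@ler_pXn2r _ 2)// ?nnegrE// real_normK ?num_real//.
apply: (@le_trans _ _ (\sum_i y i ^+ 2)).
  by rewrite (bigD1 j)//= lerDl sumr_ge0// => i _; exact: sqr_ge0.
apply: (@le_trans _ _ (k%:R * (r ^+ 2 / (1 - q)) / (1 - q))).
  by rewrite ler_pdivlMr// mulrC.
have -> : k%:R * (r ^+ 2 / (1 - q)) / (1 - q) = k%:R * (r / (1 - q)) ^+ 2.
  by field; rewrite gt_eqF.
have -> : (k%:R * r / (1 - q)) ^+ 2 = k%:R * (k%:R * (r / (1 - q)) ^+ 2).
  by field; rewrite gt_eqF.
by apply: ler_peMl => //; apply: mulr_ge0; [exact: ler0n|exact: sqr_ge0].
Qed.

End BlockSpins.

(** * Partial derivatives *)

Section LineCalculus.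
Variables (R : realType) (k : nat).
Implicit Types (f g h : 'cV[R]_k -> R) (x y : 'cV[R]_k) (i j : 'I_k).

Notation e_ i := (basis_vec R i).

Lemma is_derive_line f (v : 'cV[R]_k) x (t : R) : derivable f (x + t *: v) v ->
  is_derive t 1 (fun s : R => f (x + s *: v)) ('D_v f (x + t *: v)).
Proof.
have E : (fun h : R => h^-1 *: (((fun s : R => f (x + s *: v)) \o shift t) (h *: 1)
      - f (x + t *: v)))
  = (fun h : R => h^-1 *: ((f \o shift (x + t *: v)) (h *: v) - f (x + t *: v))).
  apply/funext => h /=; congr (_ *: (f _ - _)).
  have -> : h%:A = h :> R by rewrite /GRing.scale/= mulr1.
  by rewrite scalerDl addrCA.
by move=> df; apply: DeriveDef; rewrite /derivable /derive E.
Qed.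

(** Differentiability from a quadratic error bound. It replaces differentiation
    under the integral sign and the chain rule: error bounds can be summed and
    integrated. *)
Lemma is_derive_quadratic (u : R -> R) (t d C : R) :
  (forall h : R, `|u (t + h) - u t - h * d| <= C * h ^+ 2) -> is_derive t 1 u d.
Proof.
move=> uC.
have cv : (fun h : R => h^-1 *: ((u \o shift t) (h *: 1) - u t)) @ 0^' --> d.
  apply/cvgrPdist_le => eps eps0.
  have C0 : 0 <= C by have := uC 1; have := normr_ge0 (u (t + 1) - u t - 1 * d); lra.
  have C1 : 0 < C + 1 by lra.
  near=> h.
  have h0 : h != 0 by near: h; exact: nbhs_dnbhs_neq.
  have hs : `|h| < eps / (C + 1) by near: h; apply: dnbhs0_lt; rewrite divr_gt0.
  rewrite distrC /= /GRing.scale/= mulr1 [h + t]addrC.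
  have -> : h^-1 * (u (t + h) - u t) - d = h^-1 * (u (t + h) - u t - h * d) by field.
  rewrite normrM normfV ler_pdivrMl ?normr_gt0//.
  apply: le_trans (uC h) _; rewrite -real_normK ?num_real// expr2 mulrCA.
  rewrite ler_wpM2l//; move: hs; rewrite ltr_pdivlMr// => hs.
  by have := normr_ge0 h; nra.
apply: DeriveDef; first by apply/cvg_ex; exists d.
exact: cvg_lim.
Unshelve. all: by end_near.
Qed.

Lemma mvt_line f i x (t : R) : (forall y, derivable f y (e_ i)) -> 0 < t ->
  exists2 s, 0 < s < t & f (x + t *: e_ i) - f x = t * pderiv i f (x + s *: e_ i).
Proof.
move=> df t0; pose g (s : R) := f (x + s *: e_ i).
have gd (s : R) : is_derive s 1 g (pderiv i f (x + s *: e_ i)) by exact: is_derive_line.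
have gc : {within `[0, t], continuous g}.
  by apply: derivable_within_continuous => s _; have [] := gd s.
have [s] := @MVT R g (fun s => pderiv i f (x + s *: e_ i)) 0 t t0 (fun s _ => gd s) gc.
rewrite in_itv/= => s0t; rewrite subr0 mulrC /g scale0r addr0 => E.
by exists s.
Qed.

Lemma mvt_line_norm f i x (t : R) : (forall y, derivable f y (e_ i)) ->
  exists2 s, `|s| <= `|t| & f (x + t *: e_ i) - f x = t * pderiv i f (x + s *: e_ i).
Proof.
move=> df; have [t0|t0|->] := ltgtP t 0; last 1 first.
- by exists 0; rewrite ?lexx// scale0r addr0 subrr mul0r.
- have [|s /andP[s0 st] E] := @mvt_line f i (x + t *: e_ i) (- t) df.
    by rewrite oppr_gt0.
  exists (t + s); first by rewrite !ler0_norm; lra.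
  move: E; rewrite -!addrA -!scalerDl subrr scale0r addr0 => E.
  by rewrite -[LHS]opprB E mulNr opprK.
have [s /andP[s0 st] E] := @mvt_line f i x t df t0.
by exists s => //; rewrite !gtr0_norm// ltW.
Qed.

(** The second difference of [f] over the square of side [t] spanned by
    [e_i, e_j]. Being symmetric in [i] and [j], it equals [t ^ 2] times either
    mixed derivative at some point of the square. *)
Let double_diff f i j x (t : R) : (forall y, derivable f y (e_ i)) ->
  (forall y, derivable (pderiv i f) y (e_ j)) -> 0 < t ->
  exists s u : R, [/\ 0 < s < t, 0 < u < t &
    f (x + t *: e_ i + t *: e_ j) - f (x + t *: e_ i) - (f (x + t *: e_ j) - f x)
      = t * (t * pderiv j (pderiv i f) (x + s *: e_ i + u *: e_ j))].
Proof.
move=> df ddf t0.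
pose g (s : R) := f (x + t *: e_ j + s *: e_ i) - f (x + s *: e_ i).
pose dg (s : R) := pderiv i f (x + t *: e_ j + s *: e_ i) - pderiv i f (x + s *: e_ i).
have gd (s : R) : is_derive s 1 g (dg s).
  by rewrite /g /dg; apply: is_deriveB; exact: is_derive_line.
have gc : {within `[0, t], continuous g}.
  by apply: derivable_within_continuous => s _; have [] := gd s.
have [s] := @MVT R g dg 0 t t0 (fun s _ => gd s) gc.
rewrite in_itv/= => s0t; rewrite subr0 mulrC /g /dg !scale0r !addr0 => E.
have [u u0t E'] := @mvt_line (pderiv i f) j (x + s *: e_ i) t ddf t0.
exists s, u; split => //.
by rewrite -E' [x + t *: e_ i + _]addrAC [x + s *: e_ i + _]addrAC.
Qed.

Let dist_half (a b z e : R) : `|b - z| <= e / 2 -> `|a - z| <= e / 2 -> `|a - b| <= e.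
Proof. by rewrite !ler_norml; lra. Qed.

(** The two expressions of the second difference, at points of a square that
    shrinks to [x], give the same value in the limit. *)
Lemma schwarz f i j : (forall l y, derivable f y (e_ l)) ->
  (forall l l' y, derivable (pderiv l f) y (e_ l')) ->
  (forall l l', continuous (pderiv l' (pderiv l f))) ->
  pderiv i (pderiv j f) = pderiv j (pderiv i f).
Proof.
move=> df ddf cdf; apply/funext => x; apply/eqP; rewrite -subr_eq0 -normr_le0.
apply/ler_addgt0Pl => eps eps0; rewrite addr0.
have near_c l l' : exists2 d : R, 0 < d &
    forall y, `|y| < d -> `|pderiv l' (pderiv l f) x - pderiv l' (pderiv l f) (x + y)| <= eps / 2.
  have /cvgrPdist_le/(_ (eps / 2)) := cdf l l' x; rewrite divr_gt0// => /(_ isT).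
  move=> /nbhs_normP [d /= d0 H]; exists d => // y yd; apply: H.
  by rewrite /ball_/= opprD addrA subrr sub0r normrN.
have [d1 d10 H1] := near_c j i; have [d2 d20 H2] := near_c i j.
pose c := `|e_ i| + `|e_ j| + 1.
have c0 : 0 < c by rewrite /c ltr_wpDl// addr_ge0.
pose d := Num.min d1 d2; have d0 : 0 < d by rewrite lt_min d10.
pose t := d / c; have t0 : 0 < t by rewrite divr_gt0.
have small (s u : R) (l l' : 'I_k) : `|e_ l| + `|e_ l'| < c -> 0 < s < t -> 0 < u < t ->
    `|s *: e_ l + u *: e_ l'| < d.
  move=> ll' /andP[s0 st] /andP[u0 ut]; apply: le_lt_trans (ler_normD _ _) _.
  rewrite !normrZ !gtr0_norm//.
  apply: (@le_lt_trans _ _ (t * (`|e_ l| + `|e_ l'|))).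
    by rewrite mulrDr lerD// ler_wpM2r// ltW.
  by rewrite /t -mulrA gtr_pMr// ltr_pdivrMl// mulr1.
clearbody t.
have [s [u [s0t u0t E1]]] := double_diff x (df j) (ddf j i) t0.
have [s' [u' [s0t' u0t' E2]]] := double_diff x (df i) (ddf i j) t0.
have E : pderiv i (pderiv j f) (x + s *: e_ j + u *: e_ i) =
         pderiv j (pderiv i f) (x + s' *: e_ i + u' *: e_ j).
  apply: (mulfI (lt0r_neq0 t0)); apply: (mulfI (lt0r_neq0 t0)).
  have ac : x + t *: e_ j + t *: e_ i = x + t *: e_ i + t *: e_ j by rewrite addrAC.
  rewrite ac in E1; apply: etrans (esym E1) (etrans _ E2).
  move: (f (x + t *: e_ i + _)) (f (x + t *: e_ j)) (f (x + t *: e_ i)) (f x) => a b c' z.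
  by ring.
have ci : `|e_ i| + `|e_ j| < c by rewrite /c ltrDl.
have cj : `|e_ j| + `|e_ i| < c by rewrite addrC.
have := H1 (s *: e_ j + u *: e_ i); have := H2 (s' *: e_ i + u' *: e_ j).
have := small _ _ _ _ cj s0t u0t; have := small _ _ _ _ ci s0t' u0t'.
rewrite !addrA -E !lt_min => /andP[_ b2] /andP[b1 _] /(_ b2) + /(_ b1).
set a := pderiv i _ x; set b := pderiv j _ x; set z := pderiv i _ _.
exact: dist_half.
Qed.

Lemma Cn_continuous m f : Cn m f -> continuous f.
Proof. by case: m => [|m] //= []. Qed.

Lemma CnS_derivable m f i : Cn m.+1 f -> forall x, derivable f x (e_ i).
Proof. by move=> [_ /(_ i)[]]. Qed.

Lemma CnS_pderiv m f i : Cn m.+1 f -> Cn m (pderiv i f).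
Proof. by move=> [_ /(_ i)[]]. Qed.

Lemma CnW m f : Cn m.+1 f -> Cn m f.
Proof.
elim: m f => [|m IH] f; first by case.
move=> H; split; first exact: Cn_continuous H.
move=> i; split; first exact: CnS_derivable H.
exact/IH/CnS_pderiv.
Qed.

Lemma pderivC m f i j : Cn m.+2 f -> pderiv i (pderiv j f) = pderiv j (pderiv i f).
Proof.
move=> H; apply: schwarz => [l|l l'|l l'].
- exact: CnS_derivable H.
- exact: CnS_derivable (CnS_pderiv l H).
- exact: Cn_continuous (CnS_pderiv l' (CnS_pderiv l H)).
Qed.

Notation pderivs f s := (foldr (@pderiv R k) f s).

Lemma Cn_pderivs m f (s : seq 'I_k) : Cn (m + size s)%N f -> Cn m (pderivs f s).
Proof.
elim: s m => [|i s IH] m /=; first by rewrite addn0.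
by rewrite addnS -addSn => /IH; exact: CnS_pderiv.
Qed.

Lemma pderivs_perm f (s t : seq 'I_k) : Cn (size s) f -> perm_eq s t ->
  pderivs f s = pderivs f t.
Proof.
have move_front (i : 'I_k) (a c : seq 'I_k) : Cn (size (a ++ i :: c)) f ->
    pderivs f (a ++ i :: c) = pderivs f (i :: a ++ c).
  elim: a => [//|j a IH] /= H.
  rewrite IH; last exact: CnW H.
  rewrite /= (@pderivC 0)//; apply: Cn_pderivs.
  by move: H; rewrite !size_cat /= addnS.
elim: s t => [|i s IH] t H.
  by rewrite perm_sym => /perm_nilP ->.
move=> st; have it : i \in t by rewrite -(perm_mem st) mem_head.
have sz := perm_size st.
have [a [c tE]] : exists a c, t = a ++ i :: c.
  by case/splitPr: it => a c; exists a, c.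
rewrite tE move_front -?tE -?sz//=; congr (pderiv i _); apply: IH.
  by move: H => /=; exact: CnW.
by move: st; rewrite tE perm_sym -cat1s perm_catCA /= perm_cons perm_sym.
Qed.

(** The class [F3] bounds the derivatives taken in the increasing order of the
    coordinates; by symmetry of the derivatives the bound holds in any order. *)
Lemma F3_pderivs_le1 h (s : seq 'I_k) x : F3 h -> (0 < size s <= 3)%N ->
  `|pderivs h s x| <= 1.
Proof.
move=> [hC hb] /andP[s0 s3].
pose s' := flatten [seq nseq (count_mem i s) i | i <- enum 'I_k].
have ss' : perm_eq s s'.
  apply/allP => i _ /=; rewrite /s' count_flatten -map_comp /=.
  rewrite (eq_map (g := fun j => ((j == i) * count_mem j s)%N)); last first.
    by move=> j /=; rewrite count_nseq.
  rewrite sumnE big_map big_enum/= (bigD1 i)//= eqxx mul1n big1 ?addn0//.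
  by move=> j /negbTE ->.
have hs : Cn (size s) h.
  move: s3; case: (size s) => [|[|[|[|//]]]] _; [|do 2!apply: CnW|apply: CnW|] => //.
  by do 3!apply: CnW.
rewrite (pderivs_perm hs ss').
have -> : pderivs h s' = multi_index_deriv (fun i => count_mem i s) h.
  rewrite /multi_index_deriv /s'; elim: (enum _) => //= i l IH.
  rewrite foldr_cat IH; elim: (count_mem i s) => //= n ->//.
apply: hb.
suff -> : (\sum_(i < k) count_mem i s = size s)%N by rewrite s0.
elim: (s) => [|i l IH] /=; first by rewrite big1.
rewrite big_split/= IH (bigD1 i)//= eqxx big1 ?add1n//.
by move=> j; rewrite eq_sym => /negbTE ->.
Qed.

(** * Taylor bounds from coordinate derivatives *)

Notation combo s v := (\sum_(i <- s) v i *: e_ i).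

(** The coordinates are changed one at a time, so that the mean value theorem along
    coordinate lines suffices. *)
Lemma lipschitz_coord g (K : R) (s : seq 'I_k) (v : 'I_k -> R) x :
  (forall i y, derivable g y (e_ i)) -> (forall i y, `|pderiv i g y| <= K) ->
  `|g (x + combo s v) - g x| <= K * \sum_(i <- s) `|v i|.
Proof.
move=> dg gK; elim: s => [|i s IH]; first by rewrite !big_nil addr0 subrr normr0 mulr0.
rewrite !big_cons.
have -> : x + (v i *: e_ i + combo s v) = x + combo s v + v i *: e_ i.
  by rewrite [v i *: _ + _]addrC addrA.
have [t _ E] := mvt_line_norm (x + combo s v) (v i) (dg i).
set z := g (_ + _ *: _) in E *; set w := g (x + combo s v) in E IH.
have -> : z - g x = (z - w) + (w - g x) by ring.
apply: le_trans (ler_normD _ _) _; rewrite mulrDr lerD// E normrM mulrC.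
exact: ler_wpM2r.
Qed.

Lemma taylor1_coord g (K : R) i x (t : R) :
  (forall y, derivable g y (e_ i)) -> (forall y, derivable (pderiv i g) y (e_ i)) ->
  (forall y, `|pderiv i (pderiv i g) y| <= K) ->
  `|g (x + t *: e_ i) - g x - t * pderiv i g x| <= K * t ^+ 2.
Proof.
move=> dg ddg gK; have [s st ->] := mvt_line_norm x t dg.
have [u _ E] := mvt_line_norm x s ddg.
rewrite -mulrBr E !normrM mulrA mulrC.
have K0 : 0 <= K := le_trans (normr_ge0 _) (gK x).
apply: ler_pM => //.
by rewrite -[t ^+ 2]real_normK ?num_real// expr2 ler_wpM2l.
Qed.

Lemma taylor1_combo g (K : R) (s : seq 'I_k) (v : 'I_k -> R) x :
  (forall i y, derivable g y (e_ i)) ->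
  (forall i j y, derivable (pderiv i g) y (e_ j)) ->
  (forall i j y, `|pderiv j (pderiv i g) y| <= K) ->
  `|g (x + combo s v) - g x - \sum_(i <- s) v i * pderiv i g x|
    <= K * (\sum_(i <- s) `|v i|) ^+ 2.
Proof.
move=> dg ddg gK; elim: s => [|i s IH].
  by rewrite !big_nil addr0 !subrr normr0 expr2 !mulr0.
have K0 : 0 <= K := le_trans (normr_ge0 _) (gK i i x).
rewrite !big_cons.
have -> : x + (v i *: e_ i + combo s v) = x + combo s v + v i *: e_ i.
  by rewrite [v i *: _ + _]addrC addrA.
have H1 := taylor1_coord (x + combo s v) (v i) (dg i) (ddg i i) (gK i i).
have H2 := lipschitz_coord s v x (ddg i) (gK i).
set z := g (_ + _ *: _) in H1 *; set w := g (x + combo s v) in H1 IH.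
set S := \sum_(_ <- _) `|_| in IH H2 *; set T := \sum_(_ <- _) _ * _ in IH *.
set p := pderiv i g _ in H1 H2; set p' := pderiv i g x in H2 *.
have -> : z - g x - (v i * p' + T) = (z - w - v i * p) + (v i * (p - p')) + (w - g x - T).
  by ring.
have S0 : 0 <= S by apply: sumr_ge0.
apply: le_trans (ler_normD _ _) _; apply: le_trans (lerD (ler_normD _ _) (lexx _)) _.
rewrite [`|v i * _|]normrM.
have h := ler_wpM2l (normr_ge0 (v i)) H2.
move: H1; rewrite -[v i ^+ 2]real_normK ?num_real// => H1.
have := mulr_ge0 K0 (mulr_ge0 (normr_ge0 (v i)) S0).
lra.
Qed.

Lemma cV_combo (v : 'cV[R]_k) : v = combo (index_enum 'I_k) (fun i => v i ord0).
Proof.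
rewrite [LHS]matrix_sum_delta; apply: eq_bigr => i _.
by rewrite big_ord1.
Qed.

Definition norm1 (v : 'cV[R]_k) : R := \sum_i `|v i ord0|.

Lemma taylor1 g (K : R) x (v : 'cV[R]_k) :
  (forall i y, derivable g y (e_ i)) ->
  (forall i j y, derivable (pderiv i g) y (e_ j)) ->
  (forall i j y, `|pderiv j (pderiv i g) y| <= K) ->
  `|g (x + v) - g x - \sum_i v i ord0 * pderiv i g x| <= K * norm1 v ^+ 2.
Proof. by move=> dg ddg gK; rewrite {1}[v]cV_combo; exact: taylor1_combo. Qed.

Lemma lipschitz1 g (K : R) x (v : 'cV[R]_k) :
  (forall i y, derivable g y (e_ i)) -> (forall i y, `|pderiv i g y| <= K) ->
  `|g (x + v) - g x| <= K * norm1 v.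
Proof. by move=> dg gK; rewrite {1}[v]cV_combo; exact: lipschitz_coord. Qed.

(** The chain rule along the line [s |-> x + s v]. *)
Lemma is_derive_direction g (K : R) x (v : 'cV[R]_k) (t : R) :
  (forall i y, derivable g y (e_ i)) ->
  (forall i j y, derivable (pderiv i g) y (e_ j)) ->
  (forall i j y, `|pderiv j (pderiv i g) y| <= K) ->
  is_derive t 1 (fun s : R => g (x + s *: v)) (\sum_i v i ord0 * pderiv i g (x + t *: v)).
Proof.
move=> dg ddg gK; apply: (@is_derive_quadratic _ _ _ (K * norm1 v ^+ 2)) => h.
have := taylor1 (x + t *: v) (h *: v) dg ddg gK.
have -> : x + t *: v + h *: v = x + (t + h) *: v by rewrite -addrA -scalerDl.
have -> : \sum_i (h *: v) i ord0 * pderiv i g (x + t *: v) =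
  h * \sum_i v i ord0 * pderiv i g (x + t *: v).
  by rewrite mulr_sumr; apply: eq_bigr => i _; rewrite mxE mulrA.
have -> : norm1 (h *: v) = `|h| * norm1 v.
  by rewrite /norm1 mulr_sumr; apply: eq_bigr => i _; rewrite mxE normrM.
by rewrite exprMn real_normK ?num_real// [h ^+ 2 * _]mulrC mulrA.
Qed.

End LineCalculus.

(** * Stein's equation for the standard normal law *)

Section NormalDensity.
Variable R : realType.
Notation mu := (@lebesgue_measure R).
Notation gauss := (@normal_prob R 0 1).
Notation pdf := (@normal_pdf R 0 1).

Let gaussM : {finite_measure set _ -> \bar R} := gauss.

Let gauss_mu : gaussM `<< mu.
Proof. exact: normal_prob_dominates. Qed.

Let mpdf : measurable_fun [set: R] (EFin \o pdf).
Proof. by apply/measurable_EFinP; exact: measurable_normal_pdf. Qed.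

Lemma ge0_normal_density (f : R -> \bar R) : (forall x, 0 <= f x)%E ->
  measurable_fun setT f ->
  (\int[gauss]_x f x = \int[mu]_x (f x * (pdf x)%:E))%E.
Proof.
move=> f0 mf.
rewrite -(@Radon_Nikodym_SigmaFinite.change_of_variables _ _ R gaussM mu gauss_mu)//.
have RNi := Radon_Nikodym_SigmaFinite.f_integrable gauss_mu.
apply: ae_eq_integral => //.
- by apply: emeasurable_funM => //; exact: measurable_int RNi.
- exact: emeasurable_funM.
- apply: ae_eqe_mul2l; apply: integral_ae_eq => //.
  by move=> E _ mE; rewrite -Radon_Nikodym_SigmaFinite.f_integral.
Qed.

Lemma normal_density (f : R -> \bar R) : gauss.-integrable setT f ->
  (\int[gauss]_x f x = \int[mu]_x (f x * (pdf x)%:E))%E.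
Proof.
move=> fi; have mf := measurable_int _ fi.
rewrite -(@Radon_Nikodym_change_of_variables _ _ R gaussM mu gauss_mu)//.
apply: ae_eq_integral => //.
- exact: emeasurable_funM.
- exact: emeasurable_funM.
- apply: ae_eqe_mul2l; apply: integral_ae_eq => //.
    exact: Radon_Nikodym_integrable.
  by move=> E _ mE; rewrite -Radon_Nikodym_integral.
Qed.

Let pdfE x : pdf x = normal_peak 1 * expR (- (x ^+ 2 / 2)).
Proof.
by rewrite normal_pdfE ?oner_eq0// /normal_fun subr0 mulNr expr1n.
Qed.

(** The square is absorbed by half of the exponent, which leaves a normal density
    of variance [2]: no moment has to be computed. *)
Let sqr_pdf_le : exists C : R, 0 <= C /\ forall x : R, x ^+ 2 * pdf x <= C * normal_pdf 0 (Num.sqrt 2) x.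
Proof.
have s0 : Num.sqrt (2 : R) != 0 by rewrite gt_eqF// sqrtr_gt0.
have p1 := @normal_peak_gt0 R 1 (oner_neq0 _).
have p2 := normal_peak_gt0 s0.
exists (4 * normal_peak 1 / normal_peak (Num.sqrt 2)).
split; first by rewrite divr_ge0 ?mulr_ge0 ?ltW.
move=> x; rewrite pdfE normal_pdfE// [leRHS]mulrA divfK ?gt_eqF// /normal_fun subr0 sqr_sqrtr//.
have -> : x ^+ 2 * (normal_peak 1 * expR (- (x ^+ 2 / 2))) =
  4 * normal_peak 1 * (x ^+ 2 / 4 * expR (- (x ^+ 2 / 2))) by field.
rewrite ler_wpM2l ?mulr_ge0 ?(ltW p1)//.
have -> : - x ^+ 2 / (2 *+ 2) = - (x ^+ 2 / 2) + x ^+ 2 / 4 by field.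
rewrite expRD mulrC ler_wpM2l ?expR_ge0//.
by apply: le_trans (expR_ge1Dx _); rewrite lerDr.
Qed.

Lemma normal_sqr_integrable : gauss.-integrable setT (fun x => (x ^+ 2)%:E).
Proof.
have [C [C0 HC]] := sqr_pdf_le.
have m2 : measurable_fun [set: R] (EFin \o (fun x : R => x ^+ 2)).
  by apply/measurable_EFinP; exact: exprn_measurable.
apply/integrableP; split => //.
under eq_integral do rewrite abse_EFin ger0_norm ?sqr_ge0//.
rewrite ge0_normal_density//; last by move=> x; rewrite lee_fin sqr_ge0.
apply: (@le_lt_trans _ _ (\int[mu]_x (C%:E * (normal_pdf 0 (Num.sqrt 2) x)%:E))%E).
  apply: ge0_le_integral => //=.
  - by move=> x _; rewrite -EFinM lee_fin mulr_ge0 ?sqr_ge0 ?normal_pdf_ge0.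
  - exact: emeasurable_funM.
  - by apply: emeasurable_funM => //; apply/measurable_EFinP; exact: measurable_normal_pdf.
  - by move=> x _; rewrite -!EFinM lee_fin.
rewrite ge0_integralZl//=.
- by rewrite integral_normal_pdf mule1 ltry.
- by apply/measurable_EFinP; exact: measurable_normal_pdf.
- by move=> x _; rewrite lee_fin normal_pdf_ge0.
Qed.

Lemma normal_norm_integrable : gauss.-integrable setT (fun x => x%:E).
Proof.
have i1 : gauss.-integrable setT (fun x : R => (1 + x ^+ 2)%:E).
  under eq_fun do rewrite EFinD.
  by apply: integrableD => //; [exact: finite_measure_integrable_cst|exact: normal_sqr_integrable].
apply: le_integrable i1 => //.
  by apply/measurable_EFinP; exact: measurable_id.
move=> x _ /=; rewrite lee_fin [leRHS]ger0_norm ?addr_ge0 ?sqr_ge0//.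
by rewrite ler_norml; apply/andP; split; nra.
Qed.

Let is_derive_pdf (x : R) : is_derive x 1 pdf (- x * pdf x).
Proof.
have -> : pdf = (fun x => normal_peak 1 * expR (- (x ^+ 2 / 2))).
  by apply/funext => y; exact: pdfE.
by apply: is_derive_eq; rewrite /GRing.scale/=; field.
Qed.

Variables (f df : R -> R) (C : R).
Hypothesis f_deriv : forall x : R, is_derive x 1 f (df x).
Hypothesis df_cont : continuous df.
Hypothesis f_le : forall x : R, `|f x| <= C.
Hypothesis df_le : forall x : R, `|df x| <= C.

Let f_cont : continuous f.
Proof.
by move=> x; apply: differentiable_continuous; apply/derivable1_diffP; have [] := f_deriv x.
Qed.

Let mf : measurable_fun setT f.
Proof. exact: continuous_measurable_fun. Qed.

Let mdf : measurable_fun setT df.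
Proof. exact: continuous_measurable_fun. Qed.

Let op (x : R) := x * f x - df x.

Let mop : measurable_fun setT op.
Proof. by apply: measurable_funB => //; exact: measurable_funM. Qed.

Lemma stein_op_le x : `|op x| <= C * (1 + `|x|).
Proof.
apply: le_trans (ler_normB _ _) _; rewrite normrM mulrDr mulr1 addrC.
by apply: lerD => //; rewrite mulrC; exact: ler_wpM2r.
Qed.

Lemma stein_op_integrable : gauss.-integrable setT (fun x => (op x)%:E).
Proof.
have i1 : gauss.-integrable setT (fun x : R => (C * (1 + `|x|))%:E).
  under eq_fun do rewrite EFinM.
  apply: integrableZl => //; under eq_fun do rewrite EFinD.
  apply: integrableD => //; first exact: finite_measure_integrable_cst.
  exact: integrable_abse normal_norm_integrable.
apply: le_integrable i1 => //; first exact/measurable_EFinP.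
move=> x _ /=; rewrite lee_fin; apply: le_trans (stein_op_le x) _; exact: ler_norm.
Qed.

Let F (x : R) := f x * pdf x.
Let g (x : R) := - (op x * pdf x).

Let F_deriv (x : R) : is_derive x 1 F (g x).
Proof.
apply: (is_derive_eq (is_deriveM (f_deriv x) (is_derive_pdf x))).
by change (f x * (- x * pdf x) + pdf x * df x = g x); rewrite /g /op; ring.
Qed.

Let g_cont : continuous g.
Proof.
move=> x; apply: cvgN; apply: cvgM; last exact: continuous_normal_pdf (oner_neq0 _) x.
by apply: cvgB; [apply: cvgM; [exact: cvg_id|exact: f_cont]|exact: df_cont].
Qed.

Let g_integrable : mu.-integrable setT (fun x => (g x)%:E).
Proof.
have mg : measurable_fun [set: R] (EFin \o g).
  by apply/measurable_EFinP; exact: continuous_measurable_fun.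
apply/integrableP; split => //.
have /integrableP[_] := stein_op_integrable.
rewrite ge0_normal_density//; last first.
  by apply: measurableT_comp => //; exact/measurable_EFinP.
apply: le_lt_trans; rewrite le_eqVlt; apply/orP; left; apply/eqP.
apply: eq_integral => x _ /=.
by rewrite /g normrN normrM EFinM (ger0_norm (normal_pdf_ge0 _ _ _)).
Qed.

Let FTC (a : R) : 0 < a ->
  (\int[mu]_(x in `[(- a)%R, a]) (g x)%:E = (F a - F (- a)%R)%:E)%E.
Proof.
move=> a0; have F_cont y : continuous_at y F.
  by apply: differentiable_continuous; apply/derivable1_diffP; have [] := F_deriv y.
rewrite EFinB; apply: continuous_FTC2.
- by rewrite gtrN.
- exact: continuous_subspaceT.
- split.
  + by move=> x _; have [] := F_deriv x.
  + exact: cvg_at_right_filter (F_cont _).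
  + exact: cvg_at_left_filter (F_cont _).
- by move=> x _; rewrite derive1E; have [] := F_deriv x.
Qed.

(** A decay of order [1 / n] at the endpoints [n] and [- n] is enough. *)
Let F_le (n : nat) (x : R) : `|x| = n.+1%:R -> `|F x| <= C * normal_peak 1 * (2 * harmonic n).
Proof.
move=> xn; rewrite /F normrM (ger0_norm (normal_pdf_ge0 _ _ _)) pdfE -[leRHS]mulrA.
have -> : x ^+ 2 = n.+1%:R ^+ 2 by rewrite -xn real_normK ?num_real.
have C0 : 0 <= C := le_trans (normr_ge0 _) (f_le 0).
have p1 := @normal_peak_gt0 R 1 (oner_neq0 _).
apply: ler_pM => //; first by rewrite mulr_ge0 ?expR_ge0 ?ltW.
rewrite ler_pM2l// expRN /harmonic.
rewrite -[2 in leRHS]invrK -invfM lef_pV2 ?posrE ?expR_gt0 ?mulr_gt0//.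
apply: le_trans (expR_ge1Dx _).
have n1 : 1 <= n.+1%:R :> R by rewrite ler1n.
by have := sqr_ge0 (n.+1%:R - 1 : R); lra.
Qed.

(** Stein's equation: [(f * pdf)' = (f' - x f) pdf] integrates to zero because
    [f * pdf] vanishes at infinity. *)
Lemma normal_stein : (\int[gauss]_x (x * f x - df x)%:E = 0)%E.
Proof.
rewrite normal_density; last exact: stein_op_integrable.
have -> : (\int[mu]_x ((op x)%:E * (pdf x)%:E) = \int[mu]_x (- (g x)%:E))%E.
  by apply: eq_integral => x _; rewrite -EFinM -EFinN /g opprK.
rewrite integralN//; last first.
  exact: integrable_add_def.
suff -> : (\int[mu]_x (g x)%:E = 0)%E by rewrite oppe0.
pose I n : set R := `[(- n.+1%:R)%R, n.+1%:R]%classic.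
pose gn n : R -> \bar R := (EFin \o g) \_ (I n).
have mg : measurable_fun [set: R] (EFin \o g) by exact: measurable_int g_integrable.
have [] := @dominated_convergence _ _ R mu setT measurableT gn (EFin \o g)
   (abse \o (EFin \o g)).
- move=> n; have mI : measurable (I n) by exact: measurable_itv.
  apply: (iffLR (measurable_restrictT _ mI)).
  exact: measurable_funTS.
- exact: mg.
- apply: aeW => x _; apply: cvg_near_cst.
  exists (Num.truncn `|x|).+1 => // n /= nx.
  rewrite /gn patchE ifT// inE /I /= in_itv/= -ler_norml.
  apply: le_trans (ltW (truncnS_gt _)) _.
  by rewrite ler_nat (leq_trans nx).
- exact: integrable_abse.
- apply: aeW => x n _; rewrite /gn patchE; case: ifP => // _.
  by rewrite abse0 abse_ge0.
move=> _ _ cvg_int.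
have cvg0 : (\int[mu]_x gn n x)%E @[n --> \oo] --> 0%E.
  under eq_fun do rewrite /gn -integral_mkcond FTC ?ltr0n//.
  apply: cvg_EFin; first exact: nearW.
  apply: (@squeeze_cvgr _ _ _ _ (fun n => - (4 * (C * normal_peak 1) * harmonic n))
    (fun n => 4 * (C * normal_peak 1) * harmonic n)).
  - apply: nearW => n /=; rewrite -ler_norml.
    apply: le_trans (ler_normB _ _) _.
    have := @F_le n n.+1%:R; have := @F_le n (- n.+1%:R).
    rewrite normrN normr_nat => /(_ erefl) h1 /(_ erefl) h2.
    apply: le_trans (lerD h2 h1) _; rewrite le_eqVlt; apply/orP; left.
    by apply/eqP; rewrite /harmonic /=; ring.
  - rewrite -oppr0; apply: cvgN; rewrite -(mulr0 (4 * (C * normal_peak 1))).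
    by apply: cvgMr; exact: cvg_harmonic.
  - rewrite -(mulr0 (4 * (C * normal_peak 1))).
    by apply: cvgMr; exact: cvg_harmonic.
exact: cvg_unique cvg_int cvg0.
Qed.

End NormalDensity.

(** * Continuous functions of random vectors *)

Section ContinuousOfMeasurable.
Context d (T : measurableType d) (R : realType) (k : nat).
Variable X : 'I_k -> T -> R.
Hypothesis mX : forall i, measurable_fun setT (X i).

Let cX (w : T) : 'cV[R]_k := \col_i X i w.

(** An open set of column vectors is a countable union of rational boxes. *)
Let measurable_preimage_open (O : set 'cV[R]_k) : open O -> measurable (cX @^-1` O).
Proof.
move=> oO.
pose box (qn : {ffun 'I_k -> rat} * nat) : set 'cV[R]_k :=
  [set x | forall i, `|x i ord0 - ratr (qn.1 i)| < qn.2.+1%:R^-1].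
pose U qn : set T := if `[< box qn `<=` O >] then cX @^-1` box qn else set0.
have -> : cX @^-1` O = \bigcup_qn U qn.
  apply/seteqP; split => [w Ow|w [qn _]]; last first.
    by rewrite /U; case: asboolP => // sub; exact: sub.
  have /nbhs_ballP[e /= e0 sub] : nbhs (cX w) O by exact: open_nbhs_nbhs.
  pose n := Num.truncn (2 / e).
  have n_lt : n.+1%:R^-1 < e / 2.
    rewrite -[ltRHS]invrK ltf_pV2 ?posrE ?invr_gt0 ?divr_gt0// invf_div.
    exact: truncnS_gt.
  have qP i : exists q : rat, `|cX w i ord0 - ratr q| < n.+1%:R^-1.
    have [|q] := @rat_in_itvoo R (cX w i ord0 - n.+1%:R^-1) (cX w i ord0 + n.+1%:R^-1).
      by rewrite ltrD2l gtrN.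
    rewrite in_itv/= => /andP[q1 q2]; exists q.
    move: (cX w i ord0) (ratr q) (n.+1%:R^-1) q1 q2 => u v c q1 q2.
    by rewrite ltr_norml; apply/andP; split; lra.
  pose q : {ffun 'I_k -> rat} := [ffun i => projT1 (cid (qP i))].
  have Hq i : `|cX w i ord0 - ratr (q i)| < n.+1%:R^-1.
    by rewrite ffunE; case: cid.
  exists (q, n) => //; rewrite /U; case: asboolP => [_ i|nsub]; first exact: Hq.
  exfalso; apply: nsub => x xb; apply: sub; split => // i j; rewrite ord1 /ball/=.
  have h1 := Hq i; have h2 := xb i.
  have -> : cX w i ord0 - x i ord0 = (cX w i ord0 - ratr (q i)) - (x i ord0 - ratr (q i)).
    by ring.
  apply: le_lt_trans (ler_normB _ _) _; rewrite [ltRHS]splitr.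
  by apply: ltrD; [exact: lt_trans h1 n_lt|exact: lt_trans h2 n_lt].
apply: countable_bigcupT_measurable => // qn.
rewrite /U; case: asboolP => // _.
have -> : cX @^-1` box qn = \bigcap_(i in [set: 'I_k])
    (X i @^-1` [set y | `|y - ratr (qn.1 i)| < qn.2.+1%:R^-1]).
  apply/seteqP; split => w /=.
    by move=> H i _; have := H i; rewrite mxE.
  by move=> H i; have := H i I; rewrite mxE.
apply: fin_bigcap_measurable => [|i _]; first exact: finite_finset.
rewrite -[X in measurable X]setTI.
apply: mX => //.
have -> : [set y | `|y - ratr (qn.1 i)| < qn.2.+1%:R^-1] =
    `](ratr (qn.1 i) - qn.2.+1%:R^-1)%R, (ratr (qn.1 i) + qn.2.+1%:R^-1)%R[%classic :> set R.
  by apply/seteqP; split => y /=; rewrite in_itv/= ltr_distl.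
exact: measurable_itv.
Qed.

Lemma measurable_continuous_col (g : 'cV[R]_k -> R) : continuous g ->
  measurable_fun setT (fun w => g (\col_i X i w)).
Proof.
move=> cg; apply: (measurability _ (RGenOpens.measurableE R)) => _ [_ [a [b ->] <-]].
rewrite setTI; apply: (@measurable_preimage_open (g @^-1` `]a, b[%classic)).
by move/continuousP : cg; apply; exact: interval_open.
Qed.

End ContinuousOfMeasurable.

(** * Gaussian integration by parts *)

Section GaussianVector.
Context d (T : measurableType d) (R : realType) (P : probability T R) (k : nat).
Variable Z : 'I_k -> {RV P >-> R}.
Hypothesis Z_normal : standard_normal_vector Z.
Notation gauss := (@normal_prob R 0 1).
Notation RR := (measurableTypeR R).

Section Independence.
Variable p : 'I_k.

(** The pi-system of events that only constrain the coordinates of [Z] other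
    than the [p]-th one. Equipping the sample space with the sigma-algebra it
    generates turns independence into a product-measure statement without
    naming a space for the remaining coordinates. *)
Definition other_events : set (set T) :=
  [set A | exists2 E : 'I_k -> set R, (forall i, measurable (E i)) &
    A = [set w | forall i, i != p -> E i (Z i w)]].

Definition others := g_sigma_algebraType other_events.

Definition to_others (w : T) : others := w.

Let measurable_rectangle (E : 'I_k -> set R) : (forall i, measurable (E i)) ->
  measurable [set w | forall i, E i (Z i w)].
Proof.
move=> mE; have -> : [set w | forall i, E i (Z i w)] =
    \bigcap_(i in [set: 'I_k]) (Z i @^-1` E i).
  by apply/seteqP; split => w /= H i; [move=> _|]; exact: H.
apply: fin_bigcap_measurable => [|i _]; first exact: finite_finset.
by rewrite -[X in measurable X]setTI; exact: measurable_funPT.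
Qed.

Let other_eventsE (A : set R) (E : 'I_k -> set R) :
  Z p @^-1` A `&` [set w | forall i, i != p -> E i (Z i w)] =
  [set w | forall i, (if i == p then A else E i) (Z i w)].
Proof.
apply/seteqP; split => w /=.
  by move=> [Aw H] i; have [->//|] := eqVneq i p; exact: H.
move=> H; split; first by have := H p; rewrite eqxx.
by move=> i /negbTE ip; have := H i; rewrite ip.
Qed.

Let measurable_other_events : other_events `<=` measurable.
Proof.
move=> _ [E mE ->].
rewrite -[X in measurable X]setTI -(preimage_setT (Z p)) other_eventsE.
by apply: (@measurable_rectangle (fun i => if i == p then setT else E i)) => i; case: ifP.
Qed.

Lemma measurable_to_others : measurable_fun setT to_others.
Proof.
move=> _ Y mY; rewrite setTI.
exact: (smallest_sub (@sigma_algebra_measurable _ T) measurable_other_events).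
Qed.

HB.instance Definition _ :=
  isMeasurableFun.Build _ _ _ _ to_others measurable_to_others.

Let measurable_Zp : measurable_fun setT (Z p : T -> RR).
Proof. exact: (@measurable_funPT _ _ _ _ (Z p)). Qed.

Definition split_coord (w : T) : RR * others := (Z p w, to_others w).

Lemma measurable_split_coord : measurable_fun setT split_coord.
Proof.
by apply: measurable_fun_pair; [exact: measurable_Zp|exact: measurable_to_others].
Qed.

HB.instance Definition _ :=
  isMeasurableFun.Build _ _ _ _ split_coord measurable_split_coord.

Let prob_rectangle (A : set R) (E : 'I_k -> set R) : measurable A ->
  (forall i, measurable (E i)) ->
  P (Z p @^-1` A `&` [set w | forall i, i != p -> E i (Z i w)]) =
  (gauss A * \prod_(i < k | i != p) gauss (E i))%E.
Proof.
move=> mA mE; rewrite other_eventsE (@Z_normal (fun i => if i == p then A else E i)); last first.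
  by move=> i; case: ifP.
rewrite (bigD1 p)//= eqxx; congr (_ * _)%E.
by apply: eq_bigr => i /negbTE ->.
Qed.

Let other_events_setI : setI_closed other_events.
Proof.
move=> _ _ [E mE ->] [E' mE' ->]; exists (fun i => E i `&` E' i).
  by move=> i; exact: measurableI.
apply/seteqP; split => w /=.
  by move=> [H H'] i ip; split; [exact: H|exact: H'].
by move=> H; split=> i ip; have [] := H i ip.
Qed.

Let other_events_setT : other_events setT.
Proof. by exists (fun=> setT) => //; apply/seteqP; split. Qed.

(** Independence of [Z p] from the other coordinates: both sides are finite measures
    in [Y] that agree on the pi-system [other_events]. *)
Lemma prob_split_coord (A : set R) (Y : set others) :
  measurable A -> measurable Y ->
  P (Z p @^-1` A `&` (Y : set T)) = (gauss A * P (Y : set T))%E.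
Proof.
move=> mA mY.
have mZA : measurable (Z p @^-1` A).
  by rewrite -[X in measurable X]setTI; exact: measurable_funPT.
have gA : gauss A \is a fin_num by exact: fin_num_measure.
have gA0 : 0 <= fine (gauss A) by rewrite fine_ge0.
pose m1_ : {measure set others -> \bar R} := pushforward (mrestr P mZA) to_others.
pose m1 := m1_ measurable_to_others.
pose m2 : {measure set others -> \bar R} :=
  mscale (NngNum gA0) (distribution P to_others).
have m1E (X : set others) : m1 X = P ((X : set T) `&` Z p @^-1` A) by [].
have m2E (X : set others) : m2 X = (gauss A * P (X : set T))%E.
  by rewrite -(fineK gA).
rewrite setIC -m1E -m2E.
apply: (@measure_unique _ R others other_events (fun=> setT)) => //.
- by rewrite bigcup_const.
- move=> _ [E mE ->]; rewrite m1E m2E setIC prob_rectangle//; congr (_ * _)%E.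
  rewrite -[X in P X]setTI -[X in X `&` _](preimage_setT (Z p)) [RHS]prob_rectangle//.
  by rewrite probability_setT mul1e.
- move=> _; rewrite m1E.
  by apply: le_lt_trans (probability_le1 _ _) _; rewrite ?ltry// setTI.
Qed.

Notation law_split := (distribution P split_coord).
Notation law_others := (distribution P to_others).

Lemma law_splitE (X : set (RR * others)) : measurable X ->
  ((gauss \x law_others) X = law_split X)%E.
Proof.
apply: (@product_measure_unique _ _ _ _ _ gauss law_others law_split) => //.
by move=> A Y mA mY; exact: prob_split_coord.
Qed.

End Independence.

Lemma law_coord (A : set R) p : measurable A -> P (Z p @^-1` A) = gauss A.
Proof.
move=> mA; have := @prob_split_coord p A setT mA measurableT.
by rewrite setIT probability_setT mule1.
Qed.

Lemma expectation_coord p (f : RR -> \bar R) : (forall x, 0 <= f x)%E ->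
  measurable_fun setT f ->
  (\int[P]_w f (Z p w) = \int[gauss]_x f x)%E.
Proof.
move=> f0 mf.
have mZ : measurable_fun setT (Z p : T -> RR) by exact: (@measurable_funPT _ _ _ _ (Z p)).
pose m1_ : {measure set RR -> \bar R} := pushforward P (Z p : T -> RR).
transitivity (\int[m1_ mZ]_x f x)%E.
  by rewrite ge0_integral_pushforward.
by apply: eq_measure_integral => A mA _; exact: law_coord.
Qed.

Lemma coord_sqr_integrable p : P.-integrable setT (fun w => (Z p w ^+ 2)%:E).
Proof.
have mZ : measurable_fun setT (Z p) by exact: measurable_funPT.
apply/integrableP; split.
  by apply/measurable_EFinP; exact: measurable_funX.
have /integrableP[m2] := @normal_sqr_integrable R.
rewrite -(@expectation_coord p (fun x : RR => `|((x : R) ^+ 2)%:E|%E))//.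
by apply: measurableT_comp => //; exact: m2.
Qed.

Lemma coord_norm_integrable p : P.-integrable setT (fun w => `|Z p w|%:E).
Proof.
have i1 : P.-integrable setT (fun w => (1 + Z p w ^+ 2)%:E).
  under eq_fun do rewrite EFinD.
  apply: integrableD => //; first exact: finite_measure_integrable_cst.
  exact: coord_sqr_integrable.
apply: le_integrable i1 => //.
  by apply/measurable_EFinP; apply: measurableT_comp => //; exact: measurable_funPT.
move=> w _ /=; rewrite lee_fin [leRHS]ger0_norm ?addr_ge0 ?sqr_ge0// normr_id.
by rewrite ler_norml; apply/andP; split; nra.
Qed.

Notation e_ i := (basis_vec R i).

(** Gaussian integration by parts in the [p]-th coordinate: Stein's equation on
    the line through [e_p], integrated over the other coordinates by Fubini. *)
Lemma gaussian_ibp p (f df : 'cV[R]_k -> R) (C : R) :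
  continuous f -> continuous df ->
  (forall y, `|f y| <= C) -> (forall y, `|df y| <= C) ->
  (forall y (t : R), is_derive t 1 (fun s : R => f (y + s *: e_ p)) (df (y + t *: e_ p))) ->
  P.-integrable setT
    (fun w => (Z p w * f (random_vector Z w) - df (random_vector Z w))%:E) /\
  (\int[P]_w (Z p w * f (random_vector Z w) - df (random_vector Z w))%:E = 0)%E.
Proof.
move=> cf cdf fC dfC f_deriv.
have C0 : 0 <= C := le_trans (normr_ge0 _) (fC 0).
pose X i (zw : RR * others p) : R := if i == p then zw.1 else Z i (zw.2 : T).
have mX i : measurable_fun setT (X i).
  rewrite /X; have [_|ip] := eqVneq i p.
    exact: (@measurable_fst _ _ RR (others p)).
  apply: (@measurableT_comp _ _ _ _ _ _ (fun w : others p => Z i (w : T))) => //.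
  move=> _ Y mY; rewrite setTI.
  apply: sub_sigma_algebra; exists (fun j => if j == i then Y else setT).
    by move=> j; case: ifP.
  apply/seteqP; split => w /=.
    by move=> Yw j _; case: eqP => // ->.
  by move=> H; have := H i ip; rewrite eqxx.
pose vec zw : 'cV[R]_k := \col_i X i zw.
pose Phi (zw : RR * others p) : \bar R := ((zw.1 : R) * f (vec zw) - df (vec zw))%:E.
have vecE w : vec (split_coord p w) = random_vector Z w.
  by apply/matrixP => i j; rewrite !mxE /X; have [->|] := eqVneq i p.
have mPhi : measurable_fun setT Phi.
  apply/measurable_EFinP; apply: measurable_funB; last exact: measurable_continuous_col.
  apply: measurable_funM; last exact: measurable_continuous_col.
  exact: (@measurable_fst _ _ RR (others p)).
have PhiE : Phi \o split_coord p =
    (fun w => (Z p w * f (random_vector Z w) - df (random_vector Z w))%:E).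
  by apply/funext => w; rewrite /Phi /= vecE.
have iPhi : P.-integrable setT (Phi \o split_coord p).
  have i1 : P.-integrable setT (fun w => (C * (1 + `|Z p w|))%:E).
    under eq_fun do rewrite EFinM.
    apply: integrableZl => //; under eq_fun do rewrite EFinD.
    apply: integrableD => //; first exact: finite_measure_integrable_cst.
    exact: coord_norm_integrable.
  apply: le_integrable i1 => //.
    by apply: measurableT_comp => //; exact: measurable_split_coord.
  move=> w _ /=; rewrite lee_fin.
  rewrite [leRHS]ger0_norm ?mulr_ge0 ?addr_ge0//.
  apply: le_trans (ler_normB _ _) _; rewrite normrM mulrDr mulr1 addrC.
  by apply: lerD => //; rewrite mulrC; exact: ler_wpM2r.
split; first by rewrite -PhiE.
rewrite -PhiE.
have mS := @measurable_split_coord p.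
have iLaw : (distribution P (split_coord p)).-integrable setT Phi.
  exact: integrable_pushforward.
have iProd : (gauss \x distribution P (@to_others p))%E.-integrable setT Phi.
  move/integrableP : iLaw => [_ lt_oo]; apply/integrableP; split => //.
  rewrite (eq_measure_integral (distribution P (split_coord p)))// => A mA _.
  exact: law_splitE.
transitivity (\int[distribution P (split_coord p)]_z Phi z)%E.
  by rewrite integral_pushforward.
transitivity (\int[gauss \x distribution P (@to_others p)]_z Phi z)%E.
  by apply/esym/eq_measure_integral => A mA _; exact: law_splitE.
rewrite -integral21_prod_meas1//.
apply: integral0_eq => w _.
pose y : 'cV[R]_k := \col_i (if i == p then 0 else Z i (w : T)).
have vecE' z : vec (z, w) = y + z *: e_ p.
  apply/matrixP => i j; rewrite !mxE /X ord1 eqxx andbT /=.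
  by case: (i == p); rewrite ?mulr1 ?add0r// mulr0 addr0.
rewrite /fubini_G /Phi /=; under eq_integral do rewrite vecE'.
apply: (@normal_stein R (fun z => f (y + z *: e_ p)) (fun z => df (y + z *: e_ p)) C) => //.
move=> z; apply: continuous_comp; last exact: cdf.
apply: cvgD; first exact: cvg_cst.
by apply: cvgZr_tmp; exact: cvg_id.
Qed.

End GaussianVector.

(** * Positive semidefinite square roots *)

Section MatrixSquareRoot.
Variable R : realType.

Lemma polynomial_interpolation (g : R -> R) (s : seq R) :
  exists p : {poly R}, forall x, x \in s -> p.[x] = g x.
Proof.
elim: s => [|x s [p IH]]; first by exists 0.
have [xs|xs] := boolP (x \in s).
  by exists p => y; rewrite inE => /orP[/eqP->|]; exact: IH.
pose w := \prod_(y <- s) ('X - y%:P).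
have w0 y : (w.[y] == 0) = (y \in s).
  by rewrite -root_prod_XsubC.
exists (p + ((g x - p.[x]) / w.[x])%:P * w) => y; rewrite !hornerE inE.
case/orP => [/eqP->|ys]; first by rewrite divfK ?w0// addrC subrK.
by have /eqP -> : w.[y] == 0; [rewrite w0|rewrite mulr0 addr0 IH].
Qed.

Lemma trmx_horner_mx n (M : 'M[R]_n.+1) (p : {poly R}) :
  (horner_mx M p)^T = horner_mx M^T p.
Proof.
elim/poly_ind: p => [|p c IH]; first by rewrite !rmorph0 trmx0.
rewrite !rmorphD !rmorphM /= !horner_mx_X !horner_mx_C linearD /= trmx_mul IH.
by rewrite tr_scalar_mx; congr (_ + _); exact: comm_mx_horner.
Qed.

Lemma symmetricmxP (C : fieldType) n (M : 'M[C]_n) :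
  reflect (M^T = M) (M \is symmetricmx).
Proof.
apply: (iffP (is_hermitianmxP _ _ _)); by rewrite expr0 scale1r map_mx_id.
Qed.

(** The complex spectral theorem diagonalizes [M] with nonnegative real
    eigenvalues [r j]. A real polynomial [p] with [p (r j) = (r j) ^ (1/4)] gives
    the real symmetric matrix [p(M) ^ 2], whose square is [M]; it is positive
    semidefinite as the square of a symmetric matrix. *)
Lemma sqrtmx_exists n (M : 'M[R]_n) : possemidefmx M ->
  exists S, possemidefmx S /\ S *m S = M.
Proof.
case: n M => [|n] M [Msym Mpos].
  by exists M; split => //; apply/matrixP => -[].
pose f := real_complex R; pose MC := map_mx f M.
have MT : M^T = M by apply/symmetricmxP.
have MC_sym : MC \is symmetricmx by apply/symmetricmxP; rewrite /MC map_trmx MT.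
have MC_real : MC \is a realmx.
  by apply/mxOverP => i j; rewrite mxE complex_real.
have MCh := realsym_hermsym MC_sym MC_real.
have /orthomx_spectralP := hermitian_normalmx MCh.
have Uu := spectral_unit MC.
have dreal := hermitian_spectral_diag_real MCh.
set U := spectralmx MC in Uu *; set d := spectral_diag MC in dreal * => MCE.
have dE j : d ord0 j = f (complex.Re (d ord0 j)).
  by rewrite /f RRe_real//; move/mxOverP : dreal; exact.
pose r j := complex.Re (d ord0 j).
have eig j : eigenvalue M (r j).
  suff : eigenvalue MC (d ord0 j) by rewrite dE /MC eigenvalue_map.
  apply/eigenvalueP; exists (row j U).
    rewrite -row_mul MCE !mulmxA mulmxV// mul1mx row_mul row_diag_mx.
    by rewrite -scalemxAl -rowE.
  apply/negP => /eqP U0; have := congr1 (mulmx^~ (invmx U)) U0.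
  rewrite -row_mul mulmxV// mul0mx => /matrixP/(_ ord0 j).
  by rewrite !mxE eqxx => /eqP; rewrite oner_eq0.
have r0 j : 0 <= r j.
  have /eigenvalueP[v vM v0] := eig j.
  have := Mpos v^T; rewrite /quadform trmxK vM -scalemxAl mxE.
  have vv : 0 < (v *m v^T) ord0 ord0.
    rewrite mxE lt_neqAle; apply/andP; split; last first.
      by apply: sumr_ge0 => i _; rewrite mxE -expr2 sqr_ge0.
    apply: contra v0; rewrite eq_sym psumr_eq0; last first.
      by move=> i _; rewrite mxE -expr2 sqr_ge0.
    move/allP => v0; apply/eqP/matrixP => i j'; rewrite ord1 mxE.
    by have := v0 j' (mem_index_enum _); rewrite mxE mulf_eq0 orbb => /eqP.
  by rewrite pmulr_lge0.
have [p pE] := polynomial_interpolation (fun x => Num.sqrt (Num.sqrt x)) [seq r j | j <- enum 'I_n.+1].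
have p4 j : (p ^+ 4).[r j] = r j.
  rewrite horner_exp pE; last by rewrite map_f// mem_enum.
  by rewrite (exprM _ 2 2) !sqr_sqrtr ?sqrtr_ge0.
pose Q := horner_mx M p.
have QT : Q^T = Q by rewrite trmx_horner_mx MT.
exists (Q *m Q); split; first split.
- by apply/symmetricmxP; rewrite trmx_mul QT.
- move=> v; have -> : quadform (Q *m Q) v = ((Q *m v)^T *m (Q *m v)) ord0 ord0.
    by rewrite /quadform trmx_mul QT !mulmxA.
  by rewrite mxE; apply: sumr_ge0 => i _; rewrite mxE -expr2 sqr_ge0.
have -> : Q *m Q *m (Q *m Q) = horner_mx M (p ^+ 4).
  by rewrite rmorphXn /= (exprM _ 2 2) !expr2.
suff /matrixP H : map_mx f (horner_mx M (p ^+ 4)) = MC.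
  by apply/matrixP => i j; have := H i j; rewrite !mxE => /complexI.
rewrite map_horner_mx -/MC [in LHS]MCE.
have -> : invmx U *m diag_mx d *m U = invmx U *m diag_mx d *m invmx (invmx U) by rewrite invmxK.
rewrite horner_mx_uconj; last by rewrite unitmx_inv.
rewrite horner_mx_diag invmxK.
have -> : map_mx (horner (map_poly f (p ^+ 4))) d = d; last by rewrite -MCE.
by apply/matrixP => i j; rewrite ord1 mxE dE horner_map p4.
Qed.

Lemma sqrtmxP n (M : 'M[R]_n) : possemidefmx M ->
  possemidefmx (sqrtmx M) /\ sqrtmx M *m sqrtmx M = M.
Proof.
by move=> /sqrtmx_exists [S HS]; rewrite /sqrtmx; case: xgetP => [S' _ []//|/(_ S)].
Qed.

End MatrixSquareRoot.

(** * Expectations of real random variables *)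

Section ExpectationTools.
Context d (T : measurableType d) (R : realType) (P : probability T R).
Implicit Types f g : T -> R.

Notation L1 f := (P.-integrable setT (EFin \o f)).
Notation Ex f := (Rintegral P setT f).

Lemma L1_cst (c : R) : L1 (fun=> c).
Proof. exact: finite_measure_integrable_cst. Qed.

Lemma L1_add f g : L1 f -> L1 g -> L1 (fun w => f w + g w).
Proof.
by move=> fi gi; rewrite (_ : _ \o _ = (EFin \o f) \+ (EFin \o g))%E//; exact: integrableD.
Qed.

Lemma L1_scale (c : R) f : L1 f -> L1 (fun w => c * f w).
Proof.
move=> fi; rewrite (_ : _ \o _ = fun w => c%:E * (EFin \o f) w)%E//; exact: integrableZl.
Qed.

Lemma L1_sub f g : L1 f -> L1 g -> L1 (fun w => f w - g w).
Proof.
move=> fi gi; rewrite (_ : _ \o _ = (EFin \o f) \- (EFin \o g))%E//.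
exact: integrableB.
Qed.

Lemma L1_sum (I : Type) (s : seq I) (F : I -> T -> R) :
  (forall i, L1 (F i)) -> L1 (fun w => \sum_(i <- s) F i w).
Proof.
move=> Fi; rewrite (_ : _ \o _ = fun w => \sum_(i <- s) (EFin \o F i) w)%E.
  by apply: integrable_sum => // i _; exact: Fi.
by apply/funext => w /=; rewrite -sumEFin.
Qed.

Lemma L1_dom f g : measurable_fun setT f -> (forall w, `|f w| <= g w) -> L1 g -> L1 f.
Proof.
move=> mf fg gi; apply: le_integrable gi => //; first exact/measurable_EFinP.
by move=> w _ /=; rewrite lee_fin (le_trans (fg w))// ler_norm.
Qed.

Lemma Ex_cst (c : R) : Ex (fun=> c) = c.
Proof.
rewrite -[(fun=> c)]/(cst c) (@Rintegral_cst _ _ _ P setT measurableT c).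
rewrite -[RHS]mulr1; congr (c * _).
by rewrite -[RHS]/(fine 1%E); congr fine; exact: probability_setT.
Qed.

Lemma Ex_norm_le f (B : R) : L1 f -> (forall w, `|f w| <= B) -> `|Ex f| <= B.
Proof.
move=> fi fB; apply: le_trans (le_normr_Rintegral measurableT fi) _.
rewrite -[leRHS]Ex_cst; apply: le_Rintegral => //; last exact: L1_cst.
exact: integrable_norm.
Qed.

Lemma Ex_sum0 (I : Type) (s : seq I) (F : I -> T -> R) :
  (forall i, L1 (F i) /\ Ex (F i) = 0) -> Ex (fun w => \sum_(i <- s) F i w) = 0.
Proof.
move=> H; elim: s => [|i s IH].
  by under eq_Rintegral do rewrite big_nil; rewrite Ex_cst.
under eq_Rintegral do rewrite big_cons.
rewrite RintegralD//; first by rewrite (H i).2 IH addr0.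
- exact: (H i).1.
- by apply: L1_sum => j; exact: (H j).1.
Qed.

End ExpectationTools.

(** * Calculus on a quarter turn *)

Section Rotation.
Variable R : realType.
Implicit Types t d : R.

Let mvt_at (u du : R -> R) (t d : R) : (forall s : R, is_derive s 1 u (du s)) ->
  exists2 c, `|c - t| <= `|d| & u (t + d) - u t = d * du c.
Proof.
move=> ud.
have uc a b : {within `[a, b], continuous u}.
  by apply: derivable_within_continuous => s _; have [] := ud s.
have [d0|/ltW d0] := leP 0 d.
  have td : t <= t + d by rewrite lerDl.
  have [c] := MVT_segment td (fun s _ => ud s) (uc _ _).
  rewrite in_itv/= => /andP[c1 c2] ->; exists c; last by rewrite mulrC addrAC subrr add0r.
  by rewrite !ger0_norm// ?subr_ge0// lerBlDl.
have td : t + d <= t by rewrite gerDl.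
have [c] := MVT_segment td (fun s _ => ud s) (uc _ _).
rewrite in_itv/= => /andP[c1 c2] E; exists c.
  by rewrite !ler0_norm// ?subr_le0// opprB lerBlDl -lerBlDr opprK.
by rewrite -[LHS]opprB E; ring.
Qed.

Let mvt_lipschitz (u du : R -> R) (t d : R) : (forall s : R, is_derive s 1 u (du s)) ->
  (forall s, `|du s| <= 1) -> `|u (t + d) - u t| <= `|d|.
Proof.
by move=> ud du1; have [c _ ->] := mvt_at t d ud; rewrite normrM ler_piMr.
Qed.

Let mvt_taylor (u du ddu : R -> R) (t d : R) : (forall s : R, is_derive s 1 u (du s)) ->
  (forall s : R, is_derive s 1 du (ddu s)) -> (forall s, `|ddu s| <= 1) ->
  `|u (t + d) - u t - d * du t| <= d ^+ 2.
Proof.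
move=> ud dud du1; have [c cd ->] := mvt_at t d ud.
rewrite -mulrBr normrM -[leRHS]real_normK ?num_real// expr2 ler_wpM2l//.
have := mvt_lipschitz t (c - t) dud du1; rewrite [t + _]addrC subrK => h.
exact: le_trans h cd.
Qed.

Lemma sin_lipschitz t d : `|sin (t + d) - sin t| <= `|d|.
Proof. by apply: (@mvt_lipschitz sin cos) => s; rewrite ler_norml cos_geN1 cos_le1. Qed.

Lemma cos_lipschitz t d : `|cos (t + d) - cos t| <= `|d|.
Proof.
apply: (@mvt_lipschitz cos (fun s => - sin s)) => s.
by rewrite normrN ler_norml sin_geN1 sin_le1.
Qed.

Lemma sin_taylor t d : `|sin (t + d) - sin t - d * cos t| <= d ^+ 2.
Proof.
apply: (@mvt_taylor sin cos (fun s => - sin s)) => s.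
by rewrite normrN ler_norml sin_geN1 sin_le1.
Qed.

Lemma cos_taylor t d : `|cos (t + d) - cos t - d * - sin t| <= d ^+ 2.
Proof.
apply: (@mvt_taylor cos (fun s => - sin s) (fun s => - cos s)) => s.
by rewrite normrN ler_norml cos_geN1 cos_le1.
Qed.

(** Mean value theorem on a quarter turn, for a function whose derivative is only
    known through a quadratic error bound. *)
Lemma quarter_turn_le (psi A : R -> R) (K B : R) :
  (forall t d, `|psi (t + d) - psi t - d * A t| <= K * d ^+ 2) ->
  (forall t, `|A t| <= B) -> `|psi (pi / 2) - psi 0| <= 2 * B.
Proof.
move=> psiA AB.
have pd (s : R) : is_derive s 1 psi (A s) by exact: (@is_derive_quadratic R _ _ _ K).
have [c _] := mvt_at 0 (pi / 2) pd; rewrite add0r => ->.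
have B0 : 0 <= B := le_trans (normr_ge0 _) (AB 0).
rewrite normrM; apply: ler_pM => //.
have /andP[h1 h2] := @pihalf_02 R.
by rewrite ger0_norm ltW.
Qed.

End Rotation.

(** * The 1-norm of column vectors *)

Lemma continuous_big_sum (R : realType) (U : topologicalType) (V : normedModType R)
    (I : Type) (s : seq I) (F : I -> U -> V) :
  (forall i, continuous (F i)) -> continuous (fun u => \sum_(i <- s) F i u).
Proof.
move=> cF; elim: s => [|i s IH] u.
  by under eq_fun do rewrite big_nil; exact: cvg_cst.
under eq_fun do rewrite big_cons.
by apply: cvgD; [exact: cF|exact: IH].
Qed.

Section Norm1.
Variables (R : realType) (k : nat).
Implicit Types u v : 'cV[R]_k.

Lemma norm1_ge0 v : 0 <= norm1 v.
Proof. exact: sumr_ge0. Qed.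

Lemma norm1D u v : norm1 (u + v) <= norm1 u + norm1 v.
Proof. by rewrite -big_split; apply: ler_sum => i _; rewrite mxE ler_normD. Qed.

Lemma norm1Z (c : R) v : norm1 (c *: v) = `|c| * norm1 v.
Proof. by rewrite /norm1 mulr_sumr; apply: eq_bigr => i _; rewrite mxE normrM. Qed.

Lemma norm_le_norm1 v i : `|v i ord0| <= norm1 v.
Proof. by rewrite /norm1 (bigD1 i)//= lerDl sumr_ge0. Qed.

Definition entry_norm (S : 'M[R]_k) : R := \sum_i \sum_j `|S i j|.

Lemma norm1_mulmx (S : 'M[R]_k) v : norm1 (S *m v) <= entry_norm S * norm1 v.
Proof.
rewrite /norm1 /entry_norm mulr_suml; apply: ler_sum => i _.
rewrite mxE mulr_suml; apply: le_trans (ler_norm_sum _ _ _) _.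
by apply: ler_sum => j _; rewrite normrM ler_wpM2l// norm_le_norm1.
Qed.

Lemma sqr_sum_le (s : seq 'I_k) (u : 'I_k -> R) :
  (\sum_(i <- s) u i) ^+ 2 <= 2 ^+ size s * \sum_(i <- s) u i ^+ 2.
Proof.
elim: s => [|i s IH]; first by rewrite !big_nil expr2 !mulr0.
rewrite !big_cons /= [2 ^+ _.+1]exprS.
set a := \sum_(_ <- _) _ in IH *; set b := \sum_(_ <- _) _ in IH *; set c := 2 ^+ _ in IH *.
have c1 : 1 <= c by apply: exprn_ege1; rewrite ler1n.
have h : (u i + a) ^+ 2 <= 2 * u i ^+ 2 + 2 * a ^+ 2.
  by have := sqr_ge0 (u i - a); lra.
have := sqr_ge0 (u i) => u0.
have := ler_wpM2r u0 c1; lra.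
Qed.

Lemma continuous_mulmx (S : 'M[R]_k) : continuous (fun v : 'cV[R]_k => S *m v).
Proof.
have -> : (fun v : 'cV[R]_k => S *m v) = (fun v => \sum_j v j ord0 *: col j S).
  apply/funext => v; apply/matrixP => i j; rewrite ord1 mxE summxE.
  by apply: eq_bigr => l _; rewrite !mxE mulrC.
apply: continuous_big_sum => j v.
by apply: (@cvgZr_tmp _ _ _ (nbhs v)); exact: coord_continuous.
Qed.

End Norm1.

(** * Comparison with a Gaussian vector *)

Section GaussianComparison.
Context disp (T : measurableType disp) (R : realType) (P : probability T R) (k : nat).
Variable Z : 'I_k -> {RV P >-> R}.
Hypothesis Z_normal : standard_normal_vector Z.
Variables (X : finType) (mu : X -> R) (m : X -> 'cV[R]_k) (S : 'M[R]_k).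
Variables (h : 'cV[R]_k -> R) (B : R).
Hypothesis mu_ge0 : forall x, 0 <= mu x.
Hypothesis mu_sum : \sum_x mu x = 1.
Hypothesis S_sym : S^T = S.
Hypothesis hF3 : F3 h.

Notation L1 f := (P.-integrable setT (EFin \o f)).
Notation Ex f := (Rintegral P setT f).
Notation rv := (random_vector Z).
Notation dh i := (pderiv i h).
Notation ddh i j := (pderiv i (pderiv j h)).

Let hC : Cn 3 h. Proof. by case: hF3. Qed.
Let h_der i y : derivable h y (basis_vec R i). Proof. exact: CnS_derivable hC y. Qed.
Let dh_der i j y : derivable (dh j) y (basis_vec R i).
Proof. exact: CnS_derivable (CnS_pderiv j hC) y. Qed.
Let ddh_der i j l y : derivable (ddh j l) y (basis_vec R i).
Proof. exact: CnS_derivable (CnS_pderiv j (CnS_pderiv l hC)) y. Qed.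
Let h_cont : continuous h. Proof. exact: Cn_continuous hC. Qed.
Let dh_cont j : continuous (dh j). Proof. exact: Cn_continuous (CnS_pderiv j hC). Qed.
Let ddh_cont i j : continuous (ddh i j).
Proof. exact: Cn_continuous (CnS_pderiv i (CnS_pderiv j hC)). Qed.
Let dh_le j y : `|dh j y| <= 1. Proof. exact: (@F3_pderivs_le1 _ _ h [:: j]). Qed.
Let ddh_le i j y : `|ddh i j y| <= 1.
Proof. exact: (@F3_pderivs_le1 _ _ h [:: i; j]). Qed.
Let dddh_le i j l y : `|pderiv i (ddh j l) y| <= 1.
Proof. exact: (@F3_pderivs_le1 _ _ h [:: i; j; l]). Qed.

Let Y t x (z : 'cV[R]_k) : 'cV[R]_k := sin t *: m x + cos t *: (S *m z).

Let Y_cont t x : continuous (Y t x).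
Proof.
move=> z; apply: (@cvgD _ _ _ (nbhs z)); first exact: cvg_cst.
by apply: (@cvgZl_tmp _ _ _ (nbhs z)); exact: continuous_mulmx.
Qed.

Let comp_cont (g : 'cV[R]_k -> R) t x : continuous g -> continuous (fun z => g (Y t x z)).
Proof. by move=> cg z; apply: continuous_comp; [exact: Y_cont|exact: cg]. Qed.

Let measurable_rv (g : 'cV[R]_k -> R) : continuous g -> measurable_fun setT (fun w => g (rv w)).
Proof. by move=> cg; apply: measurable_continuous_col => // i; exact: measurable_funPT. Qed.

Let norm1_L1 : L1 (fun w => norm1 (rv w)).
Proof.
have -> : (fun w => norm1 (rv w)) = (fun w => \sum_i `|Z i w|).
  by apply/funext => w; apply: eq_bigr => i _; rewrite mxE.
by apply: L1_sum => i; exact: coord_norm_integrable.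
Qed.

Let norm1_sqr_L1 : L1 (fun w => norm1 (rv w) ^+ 2).
Proof.
apply: (@L1_dom _ _ _ _ _ (fun w => 2 ^+ size (index_enum 'I_k) * \sum_i Z i w ^+ 2)).
- by apply: measurable_funX; apply/measurable_EFinP; exact: measurable_int norm1_L1.
- move=> w; rewrite ger0_norm ?sqr_ge0//; apply: le_trans (sqr_sum_le _ _) _.
  rewrite ler_wpM2l ?exprn_ge0//; apply: ler_sum => i _.
  by rewrite real_normK ?num_real// mxE.
by apply: L1_scale; apply: L1_sum => i; exact: coord_sqr_integrable.
Qed.

(** With [z] the value of [Z]: the expectation over [Z] joins the Gaussian side at
    [t = 0] to the discrete side at [t = pi / 2]. *)
Let H t z := \sum_x mu x * h (Y t x z).

Let dH t z := \sum_x mu x *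
  \sum_j (cos t * m x j ord0 - sin t * (S *m z) j ord0) * dh j (Y t x z).

Let mbar := \sum_x norm1 (m x).

Let m_le x : norm1 (m x) <= mbar.
Proof. by rewrite /mbar (bigD1 x)//= lerDl sumr_ge0// => ? _; exact: norm1_ge0. Qed.

Let sbar := entry_norm S.

Let sbar_ge0 : 0 <= sbar.
Proof. by apply: sumr_ge0 => i _; exact: sumr_ge0. Qed.

Let term_taylor t d x z :
  `|h (Y (t + d) x z) - h (Y t x z)
    - d * \sum_j (cos t * m x j ord0 - sin t * (S *m z) j ord0) * dh j (Y t x z)|
  <= d ^+ 2 * (1 + 4 * mbar ^+ 2 + 4 * sbar ^+ 2 * norm1 z ^+ 2).
Proof.
pose a := norm1 (m x) + norm1 (S *m z).
have a0 : 0 <= a by rewrite addr_ge0 ?norm1_ge0.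
pose v := (sin (t + d) - sin t) *: m x + (cos (t + d) - cos t) *: (S *m z).
have Yv : Y (t + d) x z = Y t x z + v.
  rewrite /Y /v !scalerBl addrACA; congr (_ + _); by rewrite addrC subrK.
have vn : norm1 v <= `|d| * a.
  apply: le_trans (norm1D _ _) _; rewrite !norm1Z mulrDr lerD//.
    by rewrite ler_wpM2r ?norm1_ge0// sin_lipschitz.
  by rewrite ler_wpM2r ?norm1_ge0// cos_lipschitz.
have T1 := @taylor1 R k h 1 (Y t x z) v h_der (fun i j => @dh_der j i) (fun i j y => @ddh_le j i y).
have T2 : `|\sum_i v i ord0 * dh i (Y t x z)
   - d * \sum_j (cos t * m x j ord0 - sin t * (S *m z) j ord0) * dh j (Y t x z)|
   <= d ^+ 2 * a.
  rewrite mulr_sumr -sumrB; apply: le_trans (ler_norm_sum _ _ _) _.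
  rewrite /a /norm1 -big_split mulr_sumr; apply: ler_sum => i _ /=.
  rewrite mulrA -mulrBl normrM -[leRHS]mulr1; apply: ler_pM => //.
  have -> : v i ord0 - d * (cos t * m x i ord0 - sin t * (S *m z) i ord0) =
    (sin (t + d) - sin t - d * cos t) * m x i ord0
    + (cos (t + d) - cos t - d * - sin t) * (S *m z) i ord0.
    by rewrite /v !mxE; ring.
  apply: le_trans (ler_normD _ _) _; rewrite !normrM mulrDr.
  by apply: lerD; apply: ler_wpM2r => //; [exact: sin_taylor|exact: cos_taylor].
rewrite Yv; set g1 := h (_ + _) in T1 *; set g0 := h _ in T1 *.
set s1 := \sum_i _ in T1 T2; set s2 := d * _ in T2 *.
have -> : g1 - g0 - s2 = (g1 - g0 - s1) + (s1 - s2) by ring.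
apply: le_trans (ler_normD _ _) _.
apply: le_trans (lerD T1 T2) _.
have n2 : norm1 v ^+ 2 <= d ^+ 2 * a ^+ 2.
  rewrite -[d ^+ 2]real_normK ?num_real// -exprMn.
  by apply: lerXn2r; rewrite ?nnegrE ?norm1_ge0// mulr_ge0.
have ab : a <= mbar + sbar * norm1 z.
  by apply: lerD; [exact: m_le|exact: norm1_mulmx].
have mb0 : 0 <= mbar by exact: le_trans (norm1_ge0 _) (m_le x).
have a2 : a ^+ 2 <= 2 * mbar ^+ 2 + 2 * (sbar ^+ 2 * norm1 z ^+ 2).
  apply: (@le_trans _ _ ((mbar + sbar * norm1 z) ^+ 2)).
    by apply: lerXn2r; rewrite ?nnegrE// addr_ge0// mulr_ge0 ?norm1_ge0.
  rewrite -exprMn; move: (sbar * norm1 z) => b.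
  by have := sqr_ge0 (mbar - b); lra.
have a1 : a <= 1 + a ^+ 2 by have := sqr_ge0 (a - 1); lra.
rewrite mul1r; apply: le_trans (lerD n2 (lexx _)) _; rewrite -mulrDr.
rewrite ler_wpM2l ?sqr_ge0//; move: a1 a2; rewrite -[4 * sbar ^+ 2 * _]mulrA.
move: (sbar ^+ 2 * _) (mbar ^+ 2) (a ^+ 2) => u1 u2 u3; lra.
Qed.

Let H_taylor t d z : `|H (t + d) z - H t z - d * dH t z| <=
  d ^+ 2 * (1 + 4 * mbar ^+ 2 + 4 * sbar ^+ 2 * norm1 z ^+ 2).
Proof.
rewrite /H /dH mulr_sumr -!sumrB.
apply: le_trans (ler_norm_sum _ _ _) _.
have E (K : R) : K = \sum_x mu x * K by rewrite -mulr_suml mu_sum mul1r.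
rewrite [leRHS]E; apply: ler_sum => x _.
rewrite [d * (_ * _)]mulrCA -!mulrBr normrM ger0_norm//.
by rewrite ler_wpM2l// term_taylor.
Qed.


Let H_cont t : continuous (H t).
Proof.
apply: continuous_big_sum => x z; apply: (@cvgZl_tmp _ R^o _ (nbhs z)).
exact: (comp_cont h_cont).
Qed.

Let dH_cont t : continuous (dH t).
Proof.
apply: continuous_big_sum => x z; apply: (@cvgZl_tmp _ R^o _ (nbhs z)).
move: z; apply: continuous_big_sum => j z.
have c2 : {for z, continuous (fun z => dh j (Y t x z))} by apply: comp_cont; exact: dh_cont.
have c1 : {for z, continuous (fun z => cos t * m x j ord0 - sin t * (S *m z) j ord0)}.
  apply: (@cvgB _ R^o _ (nbhs z)); first exact: cvg_cst.
  apply: (@cvgZl_tmp _ R^o _ (nbhs z)).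
  apply: (@continuous_comp _ _ _ (fun z => S *m z) (fun v => v j ord0)).
    exact: continuous_mulmx.
  exact: coord_continuous.
exact: (continuousM c1 c2).
Qed.

Let mbar_ge0 : 0 <= mbar.
Proof. by apply: sumr_ge0 => x _; exact: norm1_ge0. Qed.

Let norm1_Y t x z : norm1 (Y t x z) <= mbar + sbar * norm1 z.
Proof.
apply: le_trans (norm1D _ _) _; rewrite !norm1Z; apply: lerD.
  apply: le_trans (m_le x); rewrite ler_piMl ?norm1_ge0// ler_norml.
  by rewrite sin_geN1 sin_le1.
apply: le_trans (norm1_mulmx S z); rewrite ler_piMl ?norm1_ge0// ler_norml.
by rewrite cos_geN1 cos_le1.
Qed.

Let norm_mean_le (F : X -> R) (C : R) : (forall x, `|F x| <= C) -> `|\sum_x mu x * F x| <= C.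
Proof.
move=> FC; have E : C = \sum_x mu x * C by rewrite -mulr_suml mu_sum mul1r.
rewrite E; apply: le_trans (ler_norm_sum _ _ _) _; apply: ler_sum => x _.
by rewrite normrM ger0_norm// ler_wpM2l.
Qed.

Let h_le y : `|h y| <= `|h 0| + norm1 y.
Proof.
have := lipschitz1 0 y h_der dh_le; rewrite add0r mul1r => l.
by rewrite -[h y](subrK (h 0)) addrC; apply: le_trans (ler_normD _ _) (lerD _ _).
Qed.

Let H_L1 t : L1 (fun w => H t (rv w)).
Proof.
apply: (@L1_dom _ _ _ _ _ (fun w => (`|h 0| + mbar) + sbar * norm1 (rv w))).
- by apply: (@measurable_rv (H t)); exact: H_cont.
- move=> w; apply: norm_mean_le => x; apply: le_trans (h_le _) _.
  by rewrite -addrA lerD2l norm1_Y.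
- by apply: L1_add; [exact: L1_cst|apply: L1_scale; exact: norm1_L1].
Qed.

Let dH_L1 t : L1 (fun w => dH t (rv w)).
Proof.
apply: (@L1_dom _ _ _ _ _ (fun w => mbar + sbar * norm1 (rv w))).
- by apply: (@measurable_rv (dH t)); exact: dH_cont.
- move=> w; apply: norm_mean_le => x; apply: le_trans (ler_norm_sum _ _ _) _.
  apply: (@le_trans _ _ (norm1 (m x) + norm1 (S *m rv w))).
    rewrite /norm1 -big_split; apply: ler_sum => j _; rewrite normrM.
    rewrite -[leRHS]mulr1; apply: ler_pM => //.
    apply: le_trans (ler_normB _ _) _; rewrite !normrM; apply: lerD.
      by rewrite ler_piMl// ler_norml cos_geN1 cos_le1.
    by rewrite ler_piMl// ler_norml sin_geN1 sin_le1.
  by apply: lerD; [exact: m_le|exact: norm1_mulmx].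
- by apply: L1_add; [exact: L1_cst|apply: L1_scale; exact: norm1_L1].
Qed.

(** Stein identity of the discrete law up to [B], for the gradient of [h] on every
    rescaled and translated copy of the support. *)
Hypothesis stein_defect_le : forall (t : R) (y : 'cV[R]_k),
  `|\sum_x mu x * \sum_j (m x j ord0 * dh j (sin t *: m x + y)
     - sin t * \sum_l (S *m S) j l * ddh l j (sin t *: m x + y))| <= B.

(** The integrand of the Gaussian integration by parts applied to [d_j h]; by the
    chain rule, differentiating along [e_p] brings the column [cos t S e_p]. *)
Let gaussian_part t x j p (z : 'cV[R]_k) :=
  z p ord0 * dh j (Y t x z) - \sum_l (cos t * S l p) * ddh l j (Y t x z).

Let gaussian_part0 t x j p : L1 (fun w => gaussian_part t x j p (rv w)) /\
  Ex (fun w => gaussian_part t x j p (rv w)) = 0.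
Proof.
pose df z := \sum_l (cos t * S l p) * ddh l j (Y t x z).
have [||||y s|] := @gaussian_ibp _ _ _ P k Z Z_normal p (fun z => dh j (Y t x z)) df (1 + sbar).
- by apply: comp_cont; exact: dh_cont.
- apply: continuous_big_sum => l z; apply: (@cvgZl_tmp _ R^o _ (nbhs z)).
  by apply: comp_cont; exact: ddh_cont.
- by move=> y; apply: le_trans (dh_le _ _) _; rewrite lerDl.
- move=> y; apply: (@le_trans _ _ sbar); last by rewrite lerDr.
  apply: le_trans (ler_norm_sum _ _ _) _; apply: ler_sum => l _.
  rewrite (bigD1 p)//= -[leLHS]addr0; apply: lerD; last exact: sumr_ge0.
  rewrite !normrM -[leRHS]mulr1; apply: ler_pM => //.
  by rewrite ler_piMl// ler_norml cos_geN1 cos_le1.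
- have E (u : R) : Y t x (y + u *: basis_vec R p) = Y t x y + u *: (cos t *: (S *m basis_vec R p)).
    by rewrite /Y mulmxDr scalerDr addrA -scalemxAr !scalerA [u * _]mulrC.
  have -> : df (y + s *: basis_vec R p) = \sum_l (cos t *: (S *m basis_vec R p)) l ord0 *
      ddh l j (Y t x y + s *: (cos t *: (S *m basis_vec R p))).
    by rewrite /df E; apply: eq_bigr => l _; rewrite -colE !mxE.
  under [X in is_derive _ _ X]eq_fun do rewrite E.
  move: (Y t x y) (cos t *: _) => y0 v.
  exact: (@is_derive_direction R k (dh j) 1 y0 v s (fun i => @dh_der i j)
    (fun i l => @ddh_der l i j) (fun i l => @dddh_le l i j)).
- move=> i1 i2; have E : (fun w => gaussian_part t x j p (rv w)) =
    (fun w => Z p w * dh j (Y t x (rv w)) - df (rv w)).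
    by apply/funext => w; rewrite /gaussian_part /df mxE.
  by rewrite E; split => //; rewrite /Rintegral i2.
Qed.

(** Adding [sin t V], which has mean zero, to [dH] exchanges the Gaussian terms for
    Hessian terms and leaves, for each [z], [cos t] times the defect of the discrete
    Stein identity translated by [cos t S z]. *)
Let dH_mean t : `|Ex (fun w => dH t (rv w))| <= B.
Proof.
pose V w := \sum_x \sum_j \sum_p (mu x * S j p) * gaussian_part t x j p (rv w).
have V0 : L1 V /\ Ex V = 0.
  split.
    apply: L1_sum => x; apply: L1_sum => j; apply: L1_sum => p; apply: L1_scale.
    exact: (gaussian_part0 t x j p).1.
  apply: Ex_sum0 => x; split.
    apply: L1_sum => j; apply: L1_sum => p; apply: L1_scale.
    exact: (gaussian_part0 t x j p).1.
  apply: Ex_sum0 => j; split.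
    by apply: L1_sum => p; apply: L1_scale; exact: (gaussian_part0 t x j p).1.
  apply: Ex_sum0 => p; have [g1 g2] := gaussian_part0 t x j p.
  by split; [exact: L1_scale|rewrite RintegralZl// g2 mulr0].
have E w : dH t (rv w) + sin t * V w = cos t *
    \sum_x mu x * \sum_j (m x j ord0 * dh j (Y t x (rv w))
     - sin t * \sum_l (S *m S) j l * ddh l j (Y t x (rv w))).
  rewrite /dH /V !mulr_sumr -big_split; apply: eq_bigr => x _ /=.
  under [in X in _ + sin t * X]eq_bigr => j _ do
    (under eq_bigr => p _ do rewrite -mulrA; rewrite -mulr_sumr).
  rewrite -mulr_sumr mulrCA -mulrDr [RHS]mulrCA; congr (mu x * _).
  rewrite !mulr_sumr -big_split; apply: eq_bigr => j _ /=.
  rewrite /gaussian_part.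
  under [in X in _ + sin t * X]eq_bigr => p _ do rewrite mulrBr mulrA.
  rewrite sumrB -mulr_suml.
  have -> : \sum_p S j p * rv w p ord0 = (S *m rv w) j ord0 by rewrite mxE.
  have -> : \sum_p S j p * (\sum_l (cos t * S l p) * ddh l j (Y t x (rv w))) =
    cos t * \sum_l (S *m S) j l * ddh l j (Y t x (rv w)).
    under eq_bigr do rewrite mulr_sumr.
    rewrite exchange_big mulr_sumr; apply: eq_bigr => l _ /=.
    rewrite !mxE mulr_suml mulr_sumr; apply: eq_bigr => p _.
    have -> : S l p = S p l by rewrite -[in LHS]S_sym mxE.
    ring.
  by move: (\sum_l _) (dh _ _) (_ ord0) (_ ord0) => u1 u2 u3 u4; ring.
have LsV : L1 (fun w => sin t * V w) by apply: L1_scale; exact: V0.1.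
have -> : Ex (fun w => dH t (rv w)) = Ex (fun w => dH t (rv w) + sin t * V w).
  rewrite RintegralD//.
  by rewrite RintegralZl//; [rewrite V0.2 mulr0 addr0|exact: V0.1].
apply: Ex_norm_le; first by apply: L1_add => //; exact: dH_L1.
move=> w; rewrite E normrM -[leRHS]mul1r; apply: ler_pM => //.
  by rewrite ler_norml cos_geN1 cos_le1.
exact: stein_defect_le.
Qed.

Let psi_taylor t d : `|Ex (fun w => H (t + d) (rv w)) - Ex (fun w => H t (rv w))
    - d * Ex (fun w => dH t (rv w))|
  <= Ex (fun w => 1 + 4 * mbar ^+ 2 + 4 * sbar ^+ 2 * norm1 (rv w) ^+ 2) * d ^+ 2.
Proof.
have LK : L1 (fun w => 1 + 4 * mbar ^+ 2 + 4 * sbar ^+ 2 * norm1 (rv w) ^+ 2).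
  by apply: L1_add; [exact: L1_cst|apply: L1_scale; exact: norm1_sqr_L1].
have LB u : L1 (fun w => H u (rv w) - H t (rv w)) by exact: L1_sub.
have LD : L1 (fun w => d * dH t (rv w)) by apply: L1_scale; exact: dH_L1.
rewrite -RintegralB//.
rewrite -RintegralZl//.
rewrite -RintegralB//.
rewrite [leRHS]mulrC -RintegralZl//.
apply: le_trans (le_normr_Rintegral _ _) _ => //.
  exact: L1_sub.
apply: le_Rintegral => //.
- by apply: integrable_norm; exact: L1_sub.
- exact: L1_scale.
Qed.

Lemma gaussian_comparison : L1 (fun w => h (S *m rv w)) /\
  `|\sum_x mu x * h (m x) - Ex (fun w => h (S *m rv w))| <= 2 * B.
Proof.
have E0 : (fun w => H 0 (rv w)) = (fun w => h (S *m rv w)).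
  apply/funext => w; rewrite /H /Y sin0 cos0; under eq_bigr do rewrite scale0r add0r scale1r.
  by rewrite -mulr_suml mu_sum mul1r.
have E1 : (fun w => H (pi / 2) (rv w)) = (fun=> \sum_x mu x * h (m x)).
  apply/funext => w; rewrite /H /Y sin_pihalf cos_pihalf.
  by under eq_bigr do rewrite scale0r addr0 scale1r.
split; first by rewrite -E0; exact: H_L1.
rewrite -E0 -[X in `|X - _|](@Ex_cst _ _ _ P) -E1.
exact: (quarter_turn_le psi_taylor dH_mean).
Qed.

End GaussianComparison.

(** * The finite-volume bound *)

Section FiniteVolume.
Context disp (T : measurableType disp) (R : realType) (P : probability T R).
Variables (k N : nat) (A : 'M[R]_k) (B : 'I_k -> {set 'I_N}) (b : 'I_N -> 'I_k).
Variable Z : 'I_k -> {RV P >-> R}.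
Hypothesis Z_normal : standard_normal_vector Z.
Hypothesis N_gt0 : (0 < N)%N.
Hypothesis A_sym : A^T = A.
Hypothesis B_blocks : ordered_blocks B.
Hypothesis b_index : block_index B b.

Notation J := (block_interaction A b).
Notation Sigma := (magnetization_covariance J B).
Notation mg := (block_magnetization R B).
Notation E f := (\sum_(x : config N) ising_measure J x * f x).

(** The quadratic form of the covariance is a mean of squares. *)
Lemma covariance_possemidef : possemidefmx Sigma.
Proof.
split.
  apply/symmetricmxP/matrixP => i j; rewrite mxE !covarianceE.
  by apply: eq_bigr => x _; rewrite [X in _ * X]mulrC.
move=> v; have -> : quadform Sigma v = E (fun x => (\sum_i v i ord0 * mg x i ord0) ^+ 2).
  rewrite /quadform mxE.
  transitivity (\sum_j \sum_i E (fun x =>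
      (v i ord0 * mg x i ord0) * (v j ord0 * mg x j ord0))).
    apply: eq_bigr => j _; rewrite mxE mulr_suml; apply: eq_bigr => i _.
    rewrite mxE covarianceE mulr_sumr mulr_suml; apply: eq_bigr => x _.
    by move: (mg x i _) (mg x j _) (v i _) (v j _) => u1 u2 u3 u4; ring.
  under eq_bigr do rewrite exchange_big /=.
  rewrite exchange_big; apply: eq_bigr => x _ /=.
  under eq_bigr do rewrite -mulr_sumr -mulr_suml.
  by rewrite -mulr_sumr -mulr_sumr expr2.
by apply: sumr_ge0 => x _; rewrite mulr_ge0 ?ising_measure_ge0 ?sqr_ge0.
Qed.

Lemma block_eps_le (g : R) i : 0 < g -> g <= block_ratio R B i ->
  block_eps R B i <= (g * Num.sqrt N%:R)^-1.
Proof.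
move=> g0 gr; have sN : 0 < Num.sqrt (N%:R : R) by rewrite sqrtr_gt0 ltr0n.
have sz : block_ratio R B i * Num.sqrt N%:R = Num.sqrt (block_size R B i).
  rewrite /block_ratio -sqrtrM ?divr_ge0// divfK// pnatr_eq0.
  by rewrite -lt0n.
rewrite /block_eps -sz lef_pV2 ?posrE ?mulr_gt0//; last exact: lt_le_trans gr.
by apply: ler_wpM2r => //; exact: ltW.
Qed.

Variables (q amax g : R).
Hypothesis q_gt0 : 0 < q.
Hypothesis q_lt1 : q < 1.
Hypothesis A_le : forall i j, `|A i j| <= amax.
Hypothesis M_contr : forall v : 'I_k -> R,
  \sum_i (\sum_j mean_field A B i j * v j) ^+ 2 <= q ^+ 2 * \sum_i v i ^+ 2.
Hypothesis g_gt0 : 0 < g.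
Hypothesis ratio_ge : forall i, g <= block_ratio R B i.

Let eta : R := (g * Num.sqrt N%:R)^-1.

(** A flip in block [i] moves the argument by [2 eps_i sin t] along [e_i], so this is
    the Taylor expansion of [d_j h] in one coordinate. *)
Lemma smooth_along_F3 (h : 'cV[R]_k -> R) (t : R) y i j : F3 h ->
  smooth_along B i 1 (fun x => pderiv j h (sin t *: mg x + y))
    (fun x => sin t * pderiv i (pderiv j h) (sin t *: mg x + y)).
Proof.
move=> hF; have hC : Cn 3 h by case: hF.
have s1 : `|sin t| <= 1 by rewrite ler_norml sin_geN1 sin_le1.
split=> [x|x|x a ai].
- apply: le_trans (@F3_pderivs_le1 _ _ h [:: j] _ hF _) _ => //.
  by rewrite mul1r lerDl; apply: sumr_ge0 => l _; exact: sqr_ge0.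
- rewrite normrM -[1]mulr1; apply: ler_pM => //.
  exact: (@F3_pderivs_le1 _ _ h [:: i; j] _ hF).
- have bi : b a = i by apply/eqP; rewrite -(in_block B_blocks b_index).
  pose u := - (2 * spin R x a ord0 * block_eps R B i * sin t).
  have -> : sin t *: mg (flip a x) + y = (sin t *: mg x + y) + u *: basis_vec R i.
    apply/matrixP => l o; rewrite ord1; move: (magnetization_flip R B_blocks b_index x a l).
    rewrite /u bi eq_sym; move: (spin R x a _) (mg (flip a x)) (mg x) => s m1 m0 E.
    rewrite mxE [(sin t *: m1) _ _]mxE E !mxE eqxx andbT.
    by case: eqP => [->|_]; rewrite ?mulr1n ?mulr0n; ring.
  have d1 y' : derivable (pderiv j h) y' (basis_vec R i).
    exact: CnS_derivable (CnS_pderiv j hC) y'.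
  have d2 y' : derivable (pderiv i (pderiv j h)) y' (basis_vec R i).
    exact: CnS_derivable (CnS_pderiv i (CnS_pderiv j hC)) y'.
  have := @taylor1_coord R k (pderiv j h) 1 i (sin t *: mg x + y) u
    d1 d2
    (fun y => @F3_pderivs_le1 _ _ h [:: i; i; j] y hF isT).
  rewrite mul1r => T1.
  set g0 := pderiv j h _ in T1 *; set g1 := pderiv j h _ in T1 *.
  set g2 := pderiv i _ _ in T1 *.
  have -> : g0 - g1 + 2 * spin R x a ord0 * block_eps R B i * (sin t * g2) = g0 - g1 - u * g2.
    by rewrite /u; ring.
  apply: le_trans T1 _; rewrite /u sqrrN !exprMn mulr1 -expr2.
  have -> : spin R x a ord0 ^+ 2 = 1 by rewrite mxE sqrr_sign.
  rewrite mulr1 -[leRHS]mulr1 (_ : 2 ^+ 2 = 4); last by rewrite expr2; ring.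
  apply: ler_wpM2l; first by rewrite mulr_ge0// sqr_ge0.
  by rewrite -[sin t ^+ 2]real_normK ?num_real// expr_le1.
Qed.

(** On the spin side the test functions are [d_j h], one for each coordinate [j],
    which accounts for the factor [k]. *)
Lemma block_clt_le (h : 'cV[R]_k -> R) : F3 h ->
  P.-integrable setT (EFin \o (fun w => h (sqrtmx Sigma *m random_vector Z w))) /\
  `|E (fun x => h (mg x)) - Rintegral P setT (fun w => h (sqrtmx Sigma *m random_vector Z w))|
    <= 2 * (k%:R * (cov_stein_const k q amax * 1 * eta)).
Proof.
move=> hF; have [[Ssym _] SS] := sqrtmxP covariance_possemidef.
apply: (gaussian_comparison Z_normal (ising_measure_ge0 J) (ising_measure_sum J)) => //.
  exact/symmetricmxP.
move=> t y; rewrite SS.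
pose F j (x : config N) := pderiv j h (sin t *: mg x + y).
pose D j l (x : config N) := sin t * pderiv l (pderiv j h) (sin t *: mg x + y).
have -> : k%:R * (cov_stein_const k q amax * 1 * eta) =
  \sum_(j < k) cov_stein_const k q amax * 1 * eta.
  by rewrite sumr_const card_ord mulr_natl.
have -> : \sum_(x : config N) ising_measure J x * \sum_j
     (mg x j ord0 * pderiv j h (sin t *: mg x + y)
      - sin t * \sum_l Sigma j l * pderiv l (pderiv j h) (sin t *: mg x + y)) =
  \sum_j (E (fun x => mg x j ord0 * F j x) - \sum_l Sigma j l * E (D j l)).
  under eq_bigr do rewrite mulr_sumr.
  rewrite exchange_big; apply: eq_bigr => j _ /=.
  under eq_bigr do rewrite mulrBr.
  rewrite sumrB; congr (_ - _).
  under [RHS]eq_bigr do rewrite mulr_sumr.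
  rewrite [RHS]exchange_big; apply: eq_bigr => x _ /=.
  rewrite !mulr_sumr; apply: eq_bigr => l _.
  rewrite /D; move: (Sigma j l) (pderiv l _ _) (ising_measure _ _) => u1 u2 u3; ring.
apply: le_trans (ler_norm_sum _ _ _) _; apply: ler_sum => j _.
apply: (cov_stein N_gt0 A_sym B_blocks b_index q_gt0 q_lt1 A_le M_contr) => i.
  exact: block_eps_le.
exact: smooth_along_F3.
Qed.

End FiniteVolume.

(** * The operator norm *)

Section OperatorNorm.
Variables (R : realType) (k : nat).
Implicit Types (M : 'M[R]_k) (v : 'cV[R]_k).

Lemma l2norm_sqr v : l2norm v ^+ 2 = \sum_i v i ord0 ^+ 2.
Proof. by rewrite sqr_sqrtr// sumr_ge0// => i _; exact: sqr_ge0. Qed.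

Lemma l2norm0 : l2norm (0 : 'cV[R]_k) = 0.
Proof. by rewrite /l2norm big1 ?sqrtr0// => i _; rewrite mxE expr0n. Qed.

Lemma l2normZ (c : R) v : l2norm (c *: v) = `|c| * l2norm v.
Proof.
rewrite /l2norm -sqrtr_sqr -sqrtrM ?sqr_ge0// mulr_sumr.
by congr Num.sqrt; apply: eq_bigr => i _; rewrite mxE exprMn.
Qed.

Lemma norm_le_l2norm v i : `|v i ord0| <= l2norm v.
Proof.
rewrite -sqrtr_sqr; apply: ler_wsqrtr; rewrite (bigD1 i)//= lerDl.
by apply: sumr_ge0 => j _; exact: sqr_ge0.
Qed.

Lemma l2norm_le_norm1 v : l2norm v <= norm1 v.
Proof.
rewrite -[leRHS]ger0_norm ?norm1_ge0// -sqrtr_sqr; apply: ler_wsqrtr.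
rewrite expr2 {1}/norm1 mulr_suml; apply: ler_sum => i _.
by rewrite -real_normK ?num_real// expr2 ler_wpM2l// norm_le_norm1.
Qed.

Lemma opnorm2_has_ubound M :
  has_ubound [set l2norm (M *m u) | u in [set u : 'cV[R]_k | l2norm u <= 1]].
Proof.
exists (entry_norm M * k%:R) => _ [u /= u1 <-].
apply: le_trans (l2norm_le_norm1 _) _; apply: le_trans (norm1_mulmx _ _) _.
apply: ler_wpM2l; first by apply: sumr_ge0 => i _; exact: sumr_ge0.
rewrite /norm1 -[k in leRHS]card_ord -sumr_const; apply: ler_sum => i _.
exact: le_trans (norm_le_l2norm u i) u1.
Qed.

Lemma l2norm_mulmx_le M v : l2norm (M *m v) <= opnorm2 M * l2norm v.
Proof.
have [v0|v0] := eqVneq (l2norm v) 0.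
  suff -> : v = 0 by rewrite mulmx0 l2norm0 mulr0.
  apply/matrixP => i j; rewrite ord1 mxE; apply/eqP.
  by rewrite -normr_le0 -v0; exact: norm_le_l2norm.
have vp : 0 < l2norm v by rewrite lt_neqAle eq_sym v0 sqrtr_ge0.
rewrite -ler_pdivrMr//.
have -> : l2norm (M *m v) / l2norm v = l2norm (M *m ((l2norm v)^-1 *: v)).
  by rewrite -scalemxAr l2normZ mulrC ger0_norm// invr_ge0 ltW.
apply: (ub_le_sup (opnorm2_has_ubound M)); exists ((l2norm v)^-1 *: v) => //=.
by rewrite l2normZ ger0_norm ?invr_ge0 ?(ltW vp)// mulVf.
Qed.

Lemma opnorm2_ge0 M : 0 <= opnorm2 M.
Proof.
apply: (@le_trans _ _ (l2norm (M *m 0))); first exact: sqrtr_ge0.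
by apply: (ub_le_sup (opnorm2_has_ubound M)); exists 0; rewrite //= l2norm0.
Qed.

End OperatorNorm.

(** * Passage to large volumes *)

(** With [D = diag (r_i / gamma_i)], where [r_i] is [block_ratio R B i], one has
    [mean_field A B = D (Gamma A Gamma) D]: the contraction factor is that of the limit
    up to the square of the largest entry of [D]. *)
Lemma mean_field_contraction (R : realType) (k N : nat) (A : 'M[R]_k)
    (B : 'I_k -> {set 'I_N}) (gamma : 'I_k -> R) (q1 rho : R) :
  (forall i, 0 < gamma i) ->
  opnorm2 (diag_mx (\row_i gamma i) *m A *m diag_mx (\row_i gamma i)) <= q1 ->
  0 <= rho -> (forall i, block_ratio R B i <= rho * gamma i) ->
  forall v : 'I_k -> R, \sum_i (\sum_j mean_field A B i j * v j) ^+ 2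
    <= (rho ^+ 2 * q1) ^+ 2 * \sum_i v i ^+ 2.
Proof.
move=> gamma0 Mq rho0 ratio_le v.
set M := _ *m _ in Mq.
pose D i := block_ratio R B i / gamma i.
have D0 i : 0 <= D i by apply: mulr_ge0; rewrite ?sqrtr_ge0 ?invr_ge0 ?ltW.
have D1 i : D i <= rho by rewrite ler_pdivrMr.
have D2 i : D i ^+ 2 <= rho ^+ 2 by apply: lerXn2r; rewrite ?nnegrE.
pose u : 'cV[R]_k := \col_i (D i * v i).
have Mu i : \sum_j mean_field A B i j * v j = D i * (M *m u) i ord0.
  rewrite mxE mulr_sumr; apply: eq_bigr => j _.
  rewrite /M mul_mx_diag mul_diag_mx !mxE /D; field.
  by rewrite !gt_eqF.
under eq_bigr do rewrite Mu exprMn.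
apply: (@le_trans _ _ (rho ^+ 2 * l2norm (M *m u) ^+ 2)).
  rewrite l2norm_sqr mulr_sumr; apply: ler_sum => i _.
  by rewrite ler_wpM2r ?sqr_ge0.
have q10 : 0 <= q1 := le_trans (opnorm2_ge0 M) Mq.
apply: (@le_trans _ _ (rho ^+ 2 * (q1 * l2norm u) ^+ 2)).
  rewrite ler_wpM2l ?sqr_ge0//; apply: lerXn2r.
  - by rewrite nnegrE sqrtr_ge0.
  - by rewrite nnegrE mulr_ge0// sqrtr_ge0.
  - apply: le_trans (l2norm_mulmx_le M u) _; apply: ler_wpM2r => //; exact: sqrtr_ge0.
rewrite exprMn l2norm_sqr.
have -> : (rho ^+ 2 * q1) ^+ 2 * \sum_i v i ^+ 2 =
  rho ^+ 2 * (q1 ^+ 2 * (rho ^+ 2 * \sum_i v i ^+ 2)) by ring.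
rewrite !ler_wpM2l ?sqr_ge0// mulr_sumr; apply: ler_sum => i _.
by rewrite mxE exprMn ler_wpM2r ?sqr_ge0.
Qed.

Theorem theorem1p5 (R : realType) (k : nat) (A : 'M[R]_k)
    (N : nat -> nat)
    (B : forall n, 'I_k -> {set 'I_(N n)})
    (b : forall n, 'I_(N n) -> 'I_k)
    (gamma : 'I_k -> R)
    (d : measure_display) (T : measurableType d) (P : probability T R)
    (Z : 'I_k -> {RV P >-> R}) :
  (0 < k)%N ->
  posdefmx A ->
  (forall n, 0 < N n)%N ->
  (forall m n, m < n -> N m < N n)%N ->
  (forall n, ordered_blocks (B n)) ->
  (forall n, block_index (B n) (b n)) ->
  (forall i, Num.sqrt (#|B n i|%:R / (N n)%:R) @[n --> \oo] --> gamma i) ->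
  (forall i, 0 < gamma i < 1) ->
  let Gamma : 'M[R]_k := diag_mx (\row_i gamma i) in
  opnorm2 (Gamma *m A *m Gamma) < 1 ->
  standard_normal_vector Z ->
  let J n := block_interaction A (b n) in
  let Sigma n := magnetization_covariance (J n) (B n) in
  exists C : R, \forall n \near \oo,
    (ereal_sup
       [set `|(ising_expectation (J n)
                 (fun x => h (block_magnetization R (B n) x)))%:E
              - 'E_P[fun w => h (sqrtmx (Sigma n) *m random_vector Z w)]|
       | h in @F3 R k]
     <= (C / Num.sqrt (N n)%:R)%:E)%E.
Proof.
move=> _ [/symmetricmxP A_sym _] N_gt0 _ B_blocks b_index ratio_cvg gamma01 Gamma M_lt1 Z_normal J Sigma.
have gamma0 i : 0 < gamma i by have /andP[] := gamma01 i.
pose q1 := (1 + opnorm2 (Gamma *m A *m Gamma)) / 2.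
have op0 := opnorm2_ge0 (Gamma *m A *m Gamma).
have q1_gt0 : 0 < q1 by rewrite /q1; lra.
have q1_lt1 : q1 < 1 by rewrite /q1; lra.
have op_le : opnorm2 (Gamma *m A *m Gamma) <= q1 by rewrite /q1; lra.
(* Slack for the block ratios: rho > 1 as q1 < 1, and
   rho^2 q1 = 4 q1 / (1 + q1)^2 < 1 as (1 - q1)^2 > 0. *)
pose rho := 2 / (1 + q1).
have rho_gt1 : 1 < rho by rewrite ltr_pdivlMr; lra.
pose q := rho ^+ 2 * q1.
have q_gt0 : 0 < q by rewrite mulr_gt0// exprn_gt0// (lt_trans _ rho_gt1).
have q_lt1 : q < 1.
  rewrite /q /rho exprMn exprVn -mulrA [_ * q1]mulrC mulrA ltr_pdivrMr ?exprn_gt0//; last lra.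
  have : 0 < (1 - q1) ^+ 2 by rewrite exprn_gt0// subr_gt0.
  nra.
(* A common lower bound for the gamma i / 2, as each of these is at most 1. *)
pose g := \prod_i (gamma i / 2).
have g_gt0 : 0 < g by apply: prodr_gt0 => i _; rewrite divr_gt0.
have g_le i : g <= gamma i / 2.
  rewrite /g (bigD1 i)//= ler_piMr//; first by have := gamma0 i; lra.
  by apply: Num.Theory.prodr_ile1 => j _; have := gamma01 j; lra.
have A_le i j : `|A i j| <= entry_norm A.
  rewrite /entry_norm (bigD1 i)//= (bigD1 j)//= -addrA lerDl addr_ge0//.
    exact: sumr_ge0.
  by apply: sumr_ge0 => ? _; exact: sumr_ge0.
exists (2 * (k%:R * cov_stein_const k q (entry_norm A)) / g).
have near_le : \forall n \near \oo, forall i, block_ratio R (B n) i <= rho * gamma i.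
  apply: filter_forall => i; apply: (cvgr_le (gamma i)); first exact: ratio_cvg.
  by rewrite ltr_pMl.
have near_ge : \forall n \near \oo, forall i, gamma i / 2 <= block_ratio R (B n) i.
  apply: filter_forall => i; apply: (cvgr_ge (gamma i)); first exact: ratio_cvg.
  by have := gamma0 i; lra.
near=> n.
apply: ge_ereal_sup => _ [h hF <-].
have ratio_le i : block_ratio R (B n) i <= rho * gamma i by move: i; near: n.
have ratio_ge i : g <= block_ratio R (B n) i.
  by apply: le_trans (g_le i) _; move: i; near: n.
have M_contr := mean_field_contraction gamma0 op_le (ltW (lt_trans ltr01 rho_gt1)) ratio_le.
have [hL hle] := block_clt_le Z_normal (N_gt0 n) A_sym (B_blocks n) (b_index n)
  q_gt0 q_lt1 A_le M_contr g_gt0 ratio_ge hF.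
have -> : 'E_P[fun w => h (sqrtmx (Sigma n) *m random_vector Z w)]%E =
  (Rintegral P setT (fun w => h (sqrtmx (Sigma n) *m random_vector Z w)))%:E.
  by rewrite unlock /Rintegral fineK// integrable_fin_num.
rewrite -EFinB abse_EFin lee_fin; apply: le_trans hle _.
have sN : 0 < Num.sqrt ((N n)%:R : R) by rewrite sqrtr_gt0 ltr0n.
rewrite le_eqVlt; apply/orP; left; apply/eqP.
rewrite mulr1; move: (cov_stein_const _ _ _) => c; field.
by rewrite !gt_eqF.
Unshelve. all: by end_near.
Qed.
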